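(* Let $(E,\mathcal{B})$ be a measurable space, $m$ a finite positive measure on it, and assume one of the following: (A$_1$) $(P_t)_{t\ge0}$ is a strongly continuous semigroup of Markovian operators on $L^p(m)$ for some $p\ge1$; or (A$_2$) $(P_t)_{t\ge0}$ is a measurable Markovian transition function on $(E,\mathcal{B})$ such that $m(f)=0$ implies $m(P_tf)=0$ for all $t>0$ and all positive $\mathcal{B}$-measurable $f$. Then the following assertions are equivalent: (i) There exists an invariant measure for $(P_t)_{t\ge0}$ which is absolutely continuous with respect to $m$. (ii) $m$ is almost invariant. (iii) $m$ is mean almost invariant with respect to every sequence $(t_n)_n$ of positive reals increasing to infinity. (iv) For every sequence $(t_n)_n$ of positive reals increasing to infinity, $c((P_t)_t,m,(t_n)_n)<m(E)$. (v) There exists a sequence $(t_n)_n$ of positive reals increasing to infinity such that $c((P_t)_t,m,(t_n)_n)<m(E)$.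
   Context: A Markovian operator on $L^p(m)$ is a linear operator preserving nonnegativity with $T1=1$. A Markovian transition function is a family of Markovian kernels $(P_t)_{t\ge 0}$ on $(E,\mathcal{B})$ with $P_tP_s=P_{t+s}$; it is measurable if $(t,x)\mapsto P_tf(x)$ is jointly measurable for every positive measurable $f$. An invariant measure for $(P_t)_{t\ge0}$ is a nonzero finite positive measure $\nu$ on $(E,\mathcal{B})$ with $\int P_tf\,d\nu=\int f\,d\nu$ for all $t>0$ and all bounded $\mathcal{B}$-measurable $f$. For a sequence $t_n\nearrow\infty$, $$c((P_t)_t,m,(t_n)_n):=\lim_{\varepsilon\searrow0}\ \sup_{A\in\mathcal{B},\,m(A)\le\varepsilon}\ \sup_n\ \frac1{t_n}\int_0^{t_n} m(P_s1_A)\,ds .$$ The measure $m$ is almost invariant if there exist $\delta\in[0,1)$ and a set function $\phi:\mathcal{B}\to\mathbb{R}_+$ with $\lim_{m(A)\to0}\phi(A)=0$ such that $m(P_t1_A)\le\delta m(E)+\phi(A)$ for all $t>0$ and $A\in\mathcal{B}$. It is mean almost invariant with respect to $(t_n)_n$ if there exist such $\delta,\phi$ with $\frac1{t_n}\int_0^{t_n} m(P_t1_A)\,dt\le\delta m(E)+\phi(A)$ for all $n$ and $A\in\mathcal{B}$. *)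

(* Defs.v *)
From HB Require Import structures.
From mathcomp Require Import all_boot all_order all_algebra.
From mathcomp Require Import all_classical all_reals all_analysis.
From mathcomp Require Import measurable_realfun lebesgue_stieltjes_measure.
Set Implicit Arguments. Unset Strict Implicit. Unset Printing Implicit Defensive.
Import Order.TTheory GRing.Theory Num.Theory.
Import numFieldNormedType.Exports.
Local Open Scope classical_set_scope.
Local Open Scope ring_scope.

Section defs.
Context {d : measure_display} {T : measurableType d} {R : realType}.

Definition opfam := R -> (T -> R) -> (T -> R).

(** ---------- Setting (A1): strongly continuous semigroup of Markovian
    operators on L^p(m).  Elements of L^p(m) are represented by measurable
    functions with finite p-norm, operators act on representatives and all
    identities are understood m-almost everywhere. *)
Definition inLp (m : {measure set T -> \bar R}) (p : R) (f : T -> R) :=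
  measurable_fun setT f /\ (Lnorm m p%:E (EFin \o f) < +oo)%E.

Definition aeeq (m : {measure set T -> \bar R}) (f g : T -> R) :=
  {ae m, forall x, f x = g x}.

Definition strongly_continuous_Markov_semigroup_Lp
    (m : {measure set T -> \bar R}) (p : R) (P : opfam) : Prop :=
  [/\ 1 <= p,
    (forall t f, 0 <= t -> inLp m p f -> inLp m p (P t f)),
    (forall t f g, 0 <= t -> inLp m p f -> inLp m p g -> aeeq m f g ->
       aeeq m (P t f) (P t g)),
    (forall t (a : R) f g, 0 <= t -> inLp m p f -> inLp m p g ->
       aeeq m (P t (fun x => a * f x + g x)) (fun x => a * P t f x + P t g x)) &
    (forall t, 0 <= t -> exists C : R, forall f, inLp m p f ->
       (Lnorm m p%:E (EFin \o P t f) <= C%:E * Lnorm m p%:E (EFin \o f))%E)] /\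
  [/\
    (forall t f, 0 <= t -> inLp m p f -> {ae m, forall x, 0 <= f x} ->
       {ae m, forall x, 0 <= P t f x}),
    (forall t, 0 <= t -> aeeq m (P t (cst 1)) (cst 1)),
    (forall f, inLp m p f -> aeeq m (P 0 f) f),
    (forall t s f, 0 <= t -> 0 <= s -> inLp m p f ->
       aeeq m (P (t + s) f) (P t (P s f))) &
    (forall f, inLp m p f ->
       (Lnorm m p%:E (EFin \o (fun x => (P t f x - f x)%R)))%E @[t --> 0^'+]
         --> 0%E)].

Definition transition_op (k : R -> R.-pker T ~> T) : opfam :=
  fun t f x => fine (\int[k t x]_y (f y)%:E)%E.

Definition measurable_Markov_transition_function
    (m : {measure set T -> \bar R}) (k : R -> R.-pker T ~> T) : Prop :=
  [/\
    (forall t s x A, 0 <= t -> 0 <= s -> measurable A ->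
       k (t + s) x A = (\int[k t x]_y k s y A)%E),
    (forall f : T -> R, (forall x, 0 <= f x) -> measurable_fun setT f ->
       measurable_fun ((`[0%R, +oo[%classic : set R) `*` [set: T])
         (fun z : R * T => (\int[k z.1 z.2]_y (f y)%:E)%E : \bar R)) &
    (forall (t : R) (f : T -> R), 0 < t -> (forall x, 0 <= f x) -> measurable_fun setT f ->
       (\int[m]_x (f x)%:E = 0)%E ->
       (\int[m]_x \int[k t x]_y (f y)%:E = 0)%E)].

Definition invariant_measure (P : opfam) (nu : {finite_measure set T -> \bar R}) :=
  nu setT != 0%E /\
  forall (t : R) (f : T -> R), 0 < t -> measurable_fun setT f ->
    (exists M : R, forall x, `|f x| <= M) ->
    (\int[nu]_x (P t f x)%:E = \int[nu]_x (f x)%:E)%E.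

Definition mP (m : {measure set T -> \bar R}) (P : opfam) (t : R) (A : set T) :=
  (\int[m]_x (P t \1_A x)%:E)%E.

Definition tavg (m : {measure set T -> \bar R}) (P : opfam) (t : R) (A : set T) :=
  ((t^-1)%:E * \int[lebesgue_measure]_(s in `[0%R, t]%classic) mP m P s A)%E.

Definition vanishing_at_null (m : {measure set T -> \bar R}) (phi : set T -> R) :=
  forall e : R, 0 < e -> exists2 eta : R, 0 < eta &
    forall A, measurable A -> (m A <= eta%:E)%E -> phi A <= e.

Definition almost_invariant (m : {measure set T -> \bar R}) (P : opfam) :=
  exists (delta : R) (phi : set T -> R),
    [/\ 0 <= delta < 1, (forall A, 0 <= phi A), vanishing_at_null m phi &
        forall t A, 0 < t -> measurable A ->
          (mP m P t A <= delta%:E * m setT + (phi A)%:E)%E].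

Definition mean_almost_invariant (m : {measure set T -> \bar R}) (P : opfam)
    (tn : nat -> R) :=
  exists (delta : R) (phi : set T -> R),
    [/\ 0 <= delta < 1, (forall A, 0 <= phi A), vanishing_at_null m phi &
        forall n A, measurable A ->
          (tavg m P (tn n) A <= delta%:E * m setT + (phi A)%:E)%E].

Definition increasing_to_infty (tn : nat -> R) :=
  [/\ forall n, 0 < tn n, nondecreasing_seq tn & tn n @[n --> \oo] --> +oo].

Definition csup (m : {measure set T -> \bar R}) (P : opfam) (tn : nat -> R)
    (eps : R) : \bar R :=
  ereal_sup [set tavg m P (tn n) A | n in setT & A in
                  [set A | measurable A /\ (m A <= eps%:E)%E]].

Definition cconst (m : {measure set T -> \bar R}) (P : opfam) (tn : nat -> R)
    : \bar R :=
  lim (csup m P tn eps @[eps --> 0^'+]).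

Definition assertions_equivalent (m : {finite_measure set T -> \bar R})
    (P : opfam) : Prop :=
  let i := exists nu : {finite_measure set T -> \bar R},
             nu `<< m /\ invariant_measure P nu in
  let ii := almost_invariant m P in
  let iii := forall tn, increasing_to_infty tn -> mean_almost_invariant m P tn in
  let iv := forall tn, increasing_to_infty tn -> (cconst m P tn < m setT)%E in
  let v := exists tn, increasing_to_infty tn /\ (cconst m P tn < m setT)%E in
  [/\ i <-> ii, ii <-> iii, iii <-> iv & iv <-> v].

End defs.

(* Main.v *)
(* By positivity, a functional on bounded functions is controlled by its values
   on indicators (layer cake).  If the constant c of some sequence is < m(E), let
   L be an ultrafilter limit of f |-> 1/t_n \int_0^{t_n} m(P_s f) ds: it is a
   positive functional with L(P_t f) = L(f), so A |-> L(1_A) is only finitely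
   additive.  The outer measure nu it generates is the largest measure below it.
   As nu o P_t is again a measure below L o P_t = L, it is <= nu, and it has the
   same mass, so nu is invariant; nu = 0 would force L to be carried by sets of
   arbitrarily small m-measure, against c < m(E).
   Conversely, if nu << m is invariant and nu >= k m on a set B with m(B) > 0,
   then m(P_t 1_A) <= m(~B) + nu(P_t 1_A) / k = m(~B) + nu(A) / k. *)

Require Import Defs.
From HB Require Import structures.
From mathcomp Require Import all_boot all_order all_algebra.
From mathcomp Require Import all_classical all_reals all_analysis.
From mathcomp Require Import measurable_realfun lebesgue_stieltjes_measure.
From mathcomp Require Import ring lra.
Import Order.TTheory GRing.Theory Num.Theory.
Import numFieldNormedType.Exports.
Local Open Scope classical_set_scope.
Local Open Scope ring_scope.

(** * Positive functionals on bounded functions *)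

(** Both settings are reduced to a single one: operators on essentially bounded functions, with
    identities valid almost everywhere at positive times. A merely finitely additive [L] has no
    convergence theorem, so every comparison is made on sets and carried to [P t \1_A] by linearity
    and positivity alone. The measure part of [L] is accessible because a measure absolutely
    continuous with respect to [m] gives little mass to what finitely many members of a countable
    cover leave out: up to a small error it sees only finite covers, and on these [L] is
    subadditive. The condition [sg_cont] is what makes [nu o P_t] continuous with respect to [m] in
    this sense. For [L] the one-sided estimate L(P_t 1_A) <= L(1_A) suffices; equality for [nu]
    comes back from complements and P_t 1 = 1. The assertions are linked in the cycle (i), (ii),
    (iii), (iv), (v), (i). *)

Section essbdd.
Context {d : measure_display} {T : measurableType d} {R : realType}.
Implicit Types (m nu : {finite_measure set T -> \bar R}) (f g : T -> R).

(** Representatives of elements of L^oo(m). The bound is only almost everywhere, because an operator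
    defined up to null sets preserves no pointwise bound. *)
Definition essbdd (m : {measure set T -> \bar R}) f :=
  measurable_fun setT f /\ exists M : R, {ae m, forall x, `|f x| <= M}.

Lemma essbdd_cst m (c : R) : essbdd m (cst c).
Proof. by split; [exact: measurable_cst|exists `|c|; exact: aeW]. Qed.

Lemma essbdd_indic m (A : set T) : measurable A -> essbdd m (\1_A : T -> R).
Proof.
move=> mA; split; first exact: measurable_indic.
by exists 1; apply: aeW => x; rewrite indicE; case: (_ \in _); rewrite ?normr1 ?normr0.
Qed.

Lemma essbdd_lin m (a : R) f g : essbdd m f -> essbdd m g ->
  essbdd m (fun x => a * f x + g x).
Proof.
move=> [mf [M fM]] [mg [N gN]]; split.
  by apply: measurable_funD => //; exact: measurable_funM.
exists (`|a| * M + N); apply: filterS2 fM gN => x fM gN.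
by rewrite (le_trans (ler_normD _ _))// lerD// normrM ler_wpM2l.
Qed.

Lemma essbddZ m (a : R) f : essbdd m f -> essbdd m (fun x => a * f x).
Proof.
move=> bf; have := essbdd_lin m a f (cst 0) bf (essbdd_cst m 0).
by under eq_fun do rewrite addr0.
Qed.

Lemma essbddB m f g : essbdd m f -> essbdd m g -> essbdd m (fun x => f x - g x).
Proof.
move=> bf bg; have := essbdd_lin m (-1) g f bg bf.
by under eq_fun do rewrite mulN1r addrC.
Qed.

Lemma essbdd_sum m k (F : nat -> T -> R) : (forall i, (i < k)%N -> essbdd m (F i)) ->
  essbdd m (fun x => \sum_(i < k) F i x).
Proof.
elim: k => [|k ih] bF.
  under eq_fun do rewrite big_ord0.
  exact: essbdd_cst.
under eq_fun do rewrite big_ord_recr/= -[X in X + _]mul1r.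
by apply: essbdd_lin; [apply: ih => i ik; exact/bF/ltnW|exact: bF].
Qed.

Lemma ae_dominates (nu m : {measure set T -> \bar R}) (Q : T -> Prop) : nu `<< m ->
  {ae m, forall x, Q x} -> {ae nu, forall x, Q x}.
Proof.
move=> /null_content_dominatesP num [A [mA A0 QA]].
by exists A; split => //; exact: num.
Qed.

Lemma essbdd_dominates m (nu : {measure set T -> \bar R}) f : nu `<< m -> essbdd m f ->
  essbdd nu f.
Proof.
by move=> num [mf [M fM]]; split => //; exists M; exact: ae_dominates fM.
Qed.

Lemma essbdd_integrable_lty (mu : {measure set T -> \bar R}) f :
  (mu setT < +oo)%E -> essbdd mu f -> mu.-integrable setT (EFin \o f).
Proof.
move=> muT [mf [M fM]]; apply/integrableP; split; first exact/measurable_EFinP.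
apply: (@le_lt_trans _ _ (\int[mu]_x (`|M|)%:E)%E).
  apply: ae_ge0_le_integral => //.
  - by do 2 apply: measurableT_comp => //.
  - apply: filterS fM => x fM _; rewrite /= lee_fin (le_trans fM)//.
    exact: ler_norm.
by rewrite integral_cst// lte_mul_pinfty// ?lee_fin.
Qed.

Lemma essbdd_integrable m f : essbdd m f -> m.-integrable setT (EFin \o f).
Proof.
apply: essbdd_integrable_lty.
by rewrite -ge0_fin_numE// fin_num_measure.
Qed.

Lemma Rintegral_ae_ge0 (mu : {measure set T -> \bar R}) f :
  measurable_fun setT f -> {ae mu, forall x, 0 <= f x} -> 0 <= \int[mu]_x f x.
Proof.
move=> mf f0; rewrite /Rintegral fine_ge0// integralE.
have -> : (\int[mu]_x ((fun x => (f x)%:E)^\- x) = 0)%E.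
  rewrite -[RHS](integral0 mu setT).
  apply: ae_eq_integral => //.
    by apply/measurable_funeneg/measurable_EFinP.
  apply: filterS f0 => x fx0 _ /=.
  by rewrite funenegE/= -EFin_max max_r// oppr_le0.
by rewrite sube0 integral_ge0.
Qed.

End essbdd.

Section pos_functional.
Context {d : measure_display} {T : measurableType d} {R : realType}.
Variable m : {finite_measure set T -> \bar R}.
Implicit Types (f g : T -> R) (Phi Psi : (T -> R) -> R).

(** No continuity is required, so finitely additive limits qualify. Positivity on almost everywhere
    nonnegative functions forces [Phi] to ignore [m]-null sets. *)
Record pos_functional Phi : Prop := PosFunctional {
  pf_lin : forall (a : R) f g, essbdd m f -> essbdd m g ->
    Phi (fun x => a * f x + g x) = a * Phi f + Phi g;
  pf_ge0 : forall f, essbdd m f -> {ae m, forall x, 0 <= f x} -> 0 <= Phi f }.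

Section theory.
Variable Phi : (T -> R) -> R.
Hypothesis pPhi : pos_functional Phi.

Lemma pf0 : Phi (cst 0) = 0.
Proof.
have := pf_lin _ pPhi (-1) _ _ (essbdd_cst m 0) (essbdd_cst m 0).
rewrite (_ : (fun x => _) = cst 0); last by apply/funext => x; rewrite /=; ring.
by move=> ->; ring.
Qed.

Lemma pfZ a f : essbdd m f -> Phi (fun x => a * f x) = a * Phi f.
Proof.
move=> bf; rewrite -[RHS]addr0 -pf0 -(pf_lin _ pPhi)//; last exact: essbdd_cst.
by congr Phi; apply/funext => x; rewrite addr0.
Qed.

Lemma pfD f g : essbdd m f -> essbdd m g ->
  Phi (fun x => f x + g x) = Phi f + Phi g.
Proof.
move=> bf bg; rewrite -[X in X + _]mul1r -(pf_lin _ pPhi)//.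
by congr Phi; apply/funext => x; rewrite mul1r.
Qed.

Lemma pfB f g : essbdd m f -> essbdd m g ->
  Phi (fun x => f x - g x) = Phi f - Phi g.
Proof.
move=> bf bg; rewrite addrC -mulN1r -(pf_lin _ pPhi)//.
by congr Phi; apply/funext => x; rewrite mulN1r addrC.
Qed.

Lemma pf_sum k (F : nat -> T -> R) : (forall i, (i < k)%N -> essbdd m (F i)) ->
  Phi (fun x => \sum_(i < k) F i x) = \sum_(i < k) Phi (F i).
Proof.
elim: k => [|k ih] bF.
  by rewrite big_ord0 -[RHS]pf0; congr Phi; apply/funext => x; rewrite big_ord0.
rewrite big_ord_recr/= -ih//; last by move=> i ik; exact/bF/ltnW.
rewrite -pfD//; last exact: bF.
  by congr Phi; apply/funext => x; rewrite big_ord_recr.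
by apply: essbdd_sum => i ik; exact/bF/ltnW.
Qed.

Lemma pf_le f g : essbdd m f -> essbdd m g -> {ae m, forall x, f x <= g x} ->
  Phi f <= Phi g.
Proof.
move=> bf bg fg; rewrite -subr_ge0 -pfB//; apply: (pf_ge0 _ pPhi).
  exact: essbddB.
by apply: filterS fg => x; rewrite subr_ge0.
Qed.

Lemma pf_ae_eq f g : essbdd m f -> essbdd m g -> aeeq m f g -> Phi f = Phi g.
Proof.
move=> bf bg fg; apply/eqP; rewrite eq_le; apply/andP; split; apply: pf_le => //;
  by apply: filterS fg => x ->.
Qed.

Lemma pf_norm_le f (M : R) : essbdd m f -> {ae m, forall x, `|f x| <= M} ->
  `|Phi f| <= `|M| * Phi (cst 1).
Proof.
move=> bf fM; have b1 := essbdd_cst m 1.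
have b (a : R) : essbdd m (fun x : T => a * cst 1 x) by exact: essbddZ.
rewrite ler_norml -mulNr.
have {}fM : {ae m, forall x, `|f x| <= `|M|}.
  by apply: filterS fM => x /le_trans; apply; exact: ler_norm.
rewrite -!pfZ//; apply/andP; split; apply: pf_le => //;
  by apply: filterS fM => x; rewrite /= mulr1 ler_norml => /andP[].
Qed.

Lemma pf_indic_ge0 A : measurable A -> 0 <= Phi \1_A.
Proof.
move=> mA; apply: (pf_ge0 _ pPhi); first exact: essbdd_indic.
by apply: aeW => x; rewrite indicE.
Qed.

Lemma pf_indicT : Phi \1_setT = Phi (cst 1).
Proof. by congr Phi; apply/funext => x; rewrite indicT. Qed.

Lemma pf_indic_le A B : measurable A -> measurable B -> A `<=` B ->
  Phi \1_A <= Phi \1_B.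
Proof.
move=> mA mB AB; apply: pf_le; [exact: essbdd_indic..|apply: aeW => x].
rewrite !indicE ler_nat.
by case: (boolP (x \in A)) => // /set_mem/AB/mem_set ->.
Qed.

Lemma pf_indicID A B : measurable A -> measurable B ->
  Phi \1_A = Phi \1_(A `&` B) + Phi \1_(A `\` B).
Proof.
move=> mA mB; rewrite -pfD; [|apply/essbdd_indic/measurableI => //|
  apply/essbdd_indic/measurableD => //].
congr Phi; apply/funext => x; rewrite !indicE in_setI in_setD.
by case: (x \in A); case: (x \in B); rewrite /= ?addr0 ?add0r.
Qed.

Lemma pf_indic_null A : measurable A -> m A = 0%E -> Phi \1_A = 0.
Proof.
move=> mA A0; rewrite -pf0; apply: pf_ae_eq.
- exact: essbdd_indic.
- exact: essbdd_cst.
- exists A; split => // x /= xA; apply: contrapT => nA; apply: xA.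
  by rewrite indicE memNset.
Qed.

End theory.

(** For 0 <= f <= 1 this is floor(k f) / k, written as a combination of indicators of superlevel
    sets. *)
Definition stair k f (x : T) : R :=
  \sum_(j < k) k%:R^-1 * \1_[set y | j.+1%:R <= k%:R * f y] x.

Lemma stair_bounds k f x : (0 < k)%N -> 0 <= f x <= 1 ->
  stair k f x <= f x <= stair k f x + k%:R^-1.
Proof.
move=> k0 /andP[fx0 fx1]; rewrite /stair -mulr_sumr.
set y := k%:R * f x; have y0 : 0 <= y by rewrite mulr_ge0.
have yk : y <= k%:R by rewrite ler_piMr.
have kR0 : 0 < k%:R :> R by rewrite ltr0n.
set N := \sum_(j < k) _; suff : N <= y <= N + 1.
  have -> : f x = k%:R^-1 * y by rewrite /y mulKf// gt_eqF.
  move=> /andP[Ny yN]; rewrite ler_pM2l ?invr_gt0// Ny/=.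
  by rewrite -[X in _ + X]mulr1 -mulrDr ler_pM2l ?invr_gt0.
have {}NE : N = \sum_(j < k) (j.+1%:R <= y)%R%:R.
  by apply: eq_bigr => j _; rewrite indicE mem_setE.
rewrite NE {N NE}; move: y y0 yk => y y0 yk {kR0 k0 fx0 fx1}.
(* The bound y <= k is lost for smaller [k], so the induction runs on a dichotomy: either all [k]
   thresholds lie below [y], or y < k and the count already brackets [y]. *)
suff : \sum_(j < k) (j.+1%:R <= y)%R%:R = k%:R :> R /\ k%:R <= y \/
    (\sum_(j < k) (j.+1%:R <= y)%R%:R <= y <= \sum_(j < k) (j.+1%:R <= y)%R%:R + 1
     /\ y < k%:R).
  by case=> [[-> ky]|[]//]; lra.
elim: k {yk} => [|k ih].
  by left; rewrite big_ord0.
rewrite big_ord_recr/=; case: (leP k.+1%:R y) => yk1 /=.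
  left; split => //; case: ih => [[-> _]|[_]]; first by rewrite natr1.
  by move: yk1; rewrite -natr1; lra.
rewrite addr0; right; split => //.
by case: ih => [[-> ky]|[]//]; move: yk1; rewrite -natr1; lra.
Qed.

Lemma essbdd_stair k f : essbdd m f -> essbdd m (stair k f).
Proof.
move=> [mf _]; apply: (@essbdd_sum _ _ _ m k
  (fun j x => k%:R^-1 * \1_[set y | j.+1%:R <= k%:R * f y] x)) => j _.
apply: essbddZ; apply: essbdd_indic.
rewrite -[X in measurable X]setTI; apply: measurable_fun_le => //.
exact: measurable_funM.
Qed.

(* A layer-cake argument: [f] is within [1/k] of the staircase built from its
   superlevel sets. *)
Lemma pf_le_of_indic Phi Psi f : pos_functional Phi -> pos_functional Psi ->
  (forall A, measurable A -> Phi \1_A <= Psi \1_A) ->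
  essbdd m f -> {ae m, forall x, 0 <= f x <= 1} -> Phi f <= Psi f.
Proof.
move=> pPhi pPsi PhiPsi bf f01; apply/ler_addgt0Pr => e e0.
have Phi1 : 0 <= Phi (cst 1).
  by apply: (pf_ge0 _ pPhi); [exact: essbdd_cst|exact: aeW].
pose k := (Num.truncn (Phi (cst 1) / e)).+1.
have k0 : 0 < k%:R :> R by rewrite ltr0n.
have ke : Phi (cst 1) * k%:R^-1 <= e.
  rewrite ler_pdivrMr// mulrC -ler_pdivrMr//.
  by rewrite ltW// truncnS_gt.
have bs := essbdd_stair k f bf.
have mS j : measurable [set y | j.+1%:R <= k%:R * f y].
  rewrite -[X in measurable X]setTI; apply: measurable_fun_le => //.
  by apply: measurable_funM => //; exact: bf.1.
have bS j : essbdd m (fun x : T => k%:R^-1 * \1_[set y | j.+1%:R <= k%:R * f y] x).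
  exact/essbddZ/essbdd_indic.
have stairE F : pos_functional F -> F (stair k f) =
    \sum_(j < k) k%:R^-1 * F \1_[set y | j.+1%:R <= k%:R * f y].
  move=> pF; rewrite (pf_sum _ pF k (fun j x => k%:R^-1 * \1_[set y | j.+1%:R <= k%:R * f y] x))//.
  by apply: eq_bigr => j _; rewrite pfZ//; exact: essbdd_indic.
apply: (@le_trans _ _ (Phi (stair k f) + e)).
  apply: (@le_trans _ _ (Phi (fun x => k%:R^-1 * cst 1 x + stair k f x))).
    apply: (pf_le _ pPhi) => //.
      by apply: essbdd_lin => //; exact: essbdd_cst.
    by apply: filterS f01 => x /(stair_bounds k f x isT) /andP[_]; rewrite /= mulr1 addrC.
  rewrite (pf_lin _ pPhi)//; last exact: essbdd_cst.
  by rewrite addrC lerD2l mulrC.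
rewrite lerD2r; apply: (@le_trans _ _ (Psi (stair k f))).
  rewrite !stairE//; apply: ler_sum => j _; rewrite ler_wpM2l ?invr_ge0//.
  exact: PhiPsi.
apply: (pf_le _ pPsi) => //.
by apply: filterS f01 => x /(stair_bounds k f x isT) /andP[].
Qed.

(** Equality on sets gives both inequalities for functions with values in [0,1]; an affine change,
    whose constant part is settled by the value on [setT], reaches every essentially bounded
    function. *)
Lemma pf_eq_of_indic Phi Psi f : pos_functional Phi -> pos_functional Psi ->
  (forall A, measurable A -> Phi \1_A = Psi \1_A) ->
  essbdd m f -> Phi f = Psi f.
Proof.
move=> pPhi pPsi PhiPsi bf; have [_ [M0 fM0]] := bf.
pose M := `|M0| + 1; have M_gt0 : 0 < M by rewrite ltr_pwDr.
have fM : {ae m, forall x, `|f x| <= M}.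
  by apply: filterS fM0 => x /le_trans; apply; rewrite (le_trans (ler_norm _))// lerDl.
pose g x := (2 * M)^-1 * f x + cst 2^-1 x.
have bg : essbdd m g by apply: essbdd_lin => //; exact: essbdd_cst.
have g01 : {ae m, forall x, 0 <= g x <= 1}.
  apply: filterS fM => x; rewrite ler_norml /g/= => fM.
  have -> : (2 * M)^-1 * f x + 2^-1 = (f x + M) / (2 * M) by field; rewrite gt_eqF.
  have ? : 0 < 2 * M by lra.
  by rewrite divr_ge0 ?ler_pdivrMr//=; lra.
have gE : Phi g = Psi g.
  by apply/eqP; rewrite eq_le; apply/andP; split; apply: pf_le_of_indic => // A mA;
    rewrite PhiPsi.
have := essbdd_cst m (- M) => bM.
have E1 F : pos_functional F -> F f = 2 * M * F g - M * F \1_setT.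
  move=> pF; rewrite pf_indicT -mulNr -(pfZ _ pF (- M)); last exact: essbdd_cst.
  rewrite (_ : (fun x => - M * cst 1 x) = cst (-M)); last first.
    by apply/funext => x; rewrite /= mulr1.
  rewrite -(pf_lin _ pF)//; congr F; apply/funext => x; rewrite /g /=.
  by field; rewrite gt_eqF.
by rewrite !E1// gE PhiPsi.
Qed.

Lemma pf_Rintegral (nu : {finite_measure set T -> \bar R}) : nu `<< m ->
  pos_functional (fun f => \int[nu]_x f x).
Proof.
move=> num; split=> [a f g bf bg|f bf f0].
  have /essbdd_integrable If := essbdd_dominates m nu f num bf.
  have /essbdd_integrable Ig := essbdd_dominates m nu g num bg.
  rewrite RintegralD//; first by rewrite RintegralZl.
  exact: (integrableZl measurableT a If).
apply: Rintegral_ae_ge0; first exact: bf.1.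
exact: ae_dominates f0.
Qed.

Lemma EFin_Rintegral_indic (nu : {finite_measure set T -> \bar R}) A : measurable A ->
  (\int[nu]_x (\1_A x : R))%:E = nu A.
Proof.
move=> mA; rewrite /Rintegral integral_indic// setIT fineK//.
exact: fin_num_measure.
Qed.

End pos_functional.

(** * The countably additive part of a positive functional *)

Section outer.
Local Open Scope ereal_scope.
Context {d : measure_display} {T : measurableType d} {R : realType}.
Variable mu : set T -> \bar R.
Hypotheses (mu0 : mu set0 = 0) (mu_ge0 : forall A, 0 <= mu A).
Hypothesis muID : forall A B, measurable A -> measurable B ->
  mu A = mu (A `&` B) + mu (A `\` B).
Hypothesis mu_fin : mu setT \is a fin_num.

Lemma mu_ext_le A : measurable A -> mu_ext mu A <= mu A.
Proof.
move=> mA; apply: ereal_inf_lbound; exists (fun n => if n is 0%N then A else set0).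
  by split=> [[]// _|t At]; exists 0%N.
apply/cvg_lim => //; rewrite -cvg_shiftS.
rewrite (_ : [sequence _]_n = cst (mu A)); first exact: cvg_cst.
by rewrite funeqE => n /=; rewrite big_nat_recl//= big1 ?adde0.
Qed.

(** Finite additivity of [mu] is enough for Caratheodory measurability: split each member of a cover
    along [A], and use that the outer measure lies below [mu]. The resulting measure may be strictly
    smaller than [mu], even zero. *)
Lemma exists_mu_ext_measure :
  exists nu : {finite_measure set T -> \bar R},
    forall A, measurable A -> nu A = mu_ext mu A.
Proof.
pose om_mix := isOuterMeasure.Build R T _ (mu_ext0 mu0 mu_ge0)
  (mu_ext_ge0 mu_ge0) (le_mu_ext mu) (mu_ext_sigma_subadditive mu_ge0).
pose om : {outer_measure set T -> \bar R} := HB.pack (mu_ext mu) om_mix.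
have cara (A : set T) : d.-measurable A -> om.-cara.-measurable A.
  move=> mA; apply: le_caratheodory_measurable => X.
  apply: le_ereal_inf_tmp => _ [B [mB XB] <-].
  rewrite (@eq_eseriesr _ _ (fun k => mu (B k `&` A) + mu (B k `\` A))); last first.
    by move=> k _; exact: muID.
  rewrite nneseriesD//; apply: leeD.
    apply: (@le_trans _ _ (om (\bigcup_k (B k `&` A)))).
      by apply: le_mu_ext; rewrite -setI_bigcupl; exact: setISS.
    apply: (le_trans (outer_measure_sigma_subadditive om _)).
    by apply: lee_nneseries => k *; [exact: outer_measure_ge0|exact/mu_ext_le/measurableI].
  apply: (@le_trans _ _ (om (\bigcup_k (B k `\` A)))).
    by apply: le_mu_ext; rewrite /setD -setI_bigcupl; exact: setISS.
  apply: (le_trans (outer_measure_sigma_subadditive om _)).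
  by apply: lee_nneseries => k *; [exact: outer_measure_ge0|exact/mu_ext_le/measurableD].
have sadd : semi_sigma_additive (mu_ext mu : set T -> \bar R).
  move=> F mF tF mUF; apply: (@caratheodory_measure_sigma_additive _ _ om) => //.
  - by move=> i; exact: cara.
  - exact: cara.
pose nu_mix := isMeasure.Build d T R (mu_ext mu) (mu_ext0 mu0 mu_ge0)
  (mu_ext_ge0 mu_ge0) sadd.
pose nu0 : {measure set T -> \bar R} := HB.pack (mu_ext mu : set T -> \bar R) nu_mix.
have nu_fin : fin_num_fun nu0.
  move=> A mA; rewrite ge0_fin_numE//.
  apply: (@le_lt_trans _ _ (mu setT)); last by rewrite -ge0_fin_numE.
  apply: (le_trans _ (mu_ext_le setT measurableT)).
  exact: le_mu_ext.
pose nu_fmix := Measure_isFinite.Build d T R nu0 nu_fin.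
pose nu : {finite_measure set T -> \bar R} := HB.pack (mu_ext mu : set T -> \bar R) nu_mix nu_fmix.
by exists nu.
Qed.

End outer.

Section ultralimit.
Context {d : measure_display} {T : measurableType d} {R : realType}.
Variable m : {finite_measure set T -> \bar R}.
Variable Phi : nat -> (T -> R) -> R.
Hypothesis pPhi : forall n, pos_functional m (Phi n).
Variable C : R.
Hypothesis PhiC : forall n, Phi n (cst 1) <= C.

(** One ultrafilter makes the limits exist for all functions at once and keeps them linear, which a
    subsequence could not do. Only eventual upper bounds are exported; lower bounds follow by
    applying them to the opposite function. *)
Lemma exists_ultralimit : exists2 L : (T -> R) -> R, pos_functional m L &
  forall f a, essbdd m f ->
    (forall e, 0 < e -> \forall n \near \oo, Phi n f <= a + e) -> L f <= a.
Proof.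
have [U [UU sU]] := @ultraFilterLemma nat \oo _.
have PU : ProperFilter U by exact: ultra_proper.
pose L f := lim (Phi n f @[n --> U]).
have Lcvg f : essbdd m f -> Phi n f @[n --> U] --> L f.
  move=> bf; have [_ [M fM]] := bf.
  have pb n : `|Phi n f| <= `|M| * C.
    by rewrite (le_trans (pf_norm_le _ _ (pPhi n) _ _ bf fM))// ler_wpM2l.
  (* The values stay in a compact segment, so the image filter has a cluster point; for an
     ultrafilter it is a limit. *)
  have [|l [_ cll]] := @segment_compact R (- (`|M| * C)) (`|M| * C)
      (Phi n f @[n --> U]) _.
    by apply: (@filterE _ U) => n; have := pb n; rewrite ler_norml /= in_itv.
  apply/cvg_ex; exists l => V lV.
  have [//|UV] := in_ultra_setVsetC ((Phi ^~ f) @^-1` V) UU.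
  by have [y []] := cll (~` V) V UV lV.
exists L.
  split=> [a f g bf bg|f bf f0].
    apply: (@cvg_lim _ _ _ U) => //.
    rewrite (_ : (fun n => _) = (fun n => a * Phi n f + Phi n g)); last first.
      by apply/funext => n; rewrite (pf_lin _ _ (pPhi n)).
    by apply: cvgD; [apply: cvgMr; exact: Lcvg|exact: Lcvg].
  apply: limr_ge; first by apply/cvg_ex; eexists; exact: Lcvg.
  by apply: filterE => n; exact: (pf_ge0 _ _ (pPhi n)).
move=> f a bf fa; apply/ler_addgt0Pr => e e0.
apply: limr_le; first by apply/cvg_ex; eexists; exact: Lcvg.
by apply: sU; exact: fa.
Qed.

End ultralimit.

Section countable_part.
Context {d : measure_display} {T : measurableType d} {R : realType}.
Variable m : {finite_measure set T -> \bar R}.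
Variable L : (T -> R) -> R.
Hypothesis pL : pos_functional m L.

(** Continuity from above of the finite measure [m]: the parts left uncovered decrease to the empty
    set. This replaces a countable cover by a finite one, on which finite additivity can act. *)
Lemma cover_tail (A : set T) (B : nat -> set T) (e : R) : measurable A ->
  (forall k, measurable (B k)) -> A `<=` \bigcup_k B k -> 0 < e ->
  exists N, (m (A `\` \big[setU/set0]_(k < N) B k) <= e%:E)%E.
Proof.
move=> mA mB AB e0.
pose F N := A `\` \big[setU/set0]_(k < N) B k.
have mF N : measurable (F N).
  by apply: measurableD => //; apply: bigsetU_measurable => k _.
have F0 : \bigcap_N F N = set0.
  rewrite -subset0 => x Fx; have [Ax _] := Fx 0%N I.
  have [k _ Bkx] := AB x Ax; have [_] := Fx k.+1 I; apply.
  by rewrite -bigcup_mkord; exists k => /=.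
have : (m \o F) x @[x --> \oo] --> m (\bigcap_N F N).
  apply: nonincreasing_cvg_mu => //.
  - by rewrite -ge0_fin_numE// fin_num_measure.
  - by rewrite F0.
  - move=> i j ij; apply/subsetPset; apply: setDS.
    by apply: subset_bigsetU.
rewrite F0 measure0 => /fine_cvgP[_] /cvgrPdist_le /(_ _ e0) [N _ /(_ N (leqnn N))] /=.
rewrite sub0r normrN => FNe; exists N; rewrite -/(F N).
rewrite -[leLHS]fineK ?fin_num_measure// lee_fin.
exact: le_trans (ler_norm _) FNe.
Qed.

(* [nu] is the Caratheodory outer measure of [A |-> L \1_A]: it is the largest
   measure below [L], and when it vanishes [L] is carried by sets of
   arbitrarily small [m]-measure. *)
Lemma exists_countable_part :
  exists nu : {finite_measure set T -> \bar R},
  [/\ nu `<< m,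
    forall A, measurable A -> (nu A <= (L \1_A)%:E)%E,
    forall l, pos_functional m l ->
      (forall e, 0 < e -> exists2 eta, 0 < eta &
         forall A, measurable A -> (m A <= eta%:E)%E -> l \1_A <= e) ->
      (forall A, measurable A -> l \1_A <= L \1_A) ->
      forall A, measurable A -> ((l \1_A)%:E <= nu A)%E &
    nu setT = 0%E -> forall e, 0 < e -> exists A, [/\ measurable A,
      (m A <= e%:E)%E & L (cst 1) <= L \1_A + e]].
Proof.
(* The absolute value only matters on nonmeasurable sets: the outer measure construction asks for
   nonnegativity everywhere. *)
pose mu A := (`|L \1_A|)%:E.
have muE A : measurable A -> mu A = (L \1_A)%:E.
  by move=> mA; rewrite /mu ger0_norm//; exact: (pf_indic_ge0 _ _ pL).
have mu0 : mu set0 = 0%E.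
  by rewrite /mu indic0 (pf0 _ _ pL) normr0.
have mu_ge0 A : (0 <= mu A)%E by rewrite lee_fin.
have [|//|nu nuE] := exists_mu_ext_measure mu mu0 mu_ge0.
  move=> A B mA mB; rewrite !muE//; [|exact: measurableD|exact: measurableI].
  by rewrite -EFinD (pf_indicID _ _ pL _ _ mA mB).
have nu_le A : measurable A -> (nu A <= (L \1_A)%:E)%E.
  by move=> mA; rewrite nuE// -muE//; exact: mu_ext_le.
have pf_bigsetU l (B : nat -> set T) N : pos_functional m l ->
    (forall k, measurable (B k)) ->
    l \1_(\big[setU/set0]_(k < N) B k) <= \sum_(k < N) l \1_(B k).
  move=> pl mB; elim: N => [|N ih].
    by rewrite !big_ord0 indic0 (pf0 _ _ pl).
  have mN : measurable (\big[setU/set0]_(k < N) B k).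
    by apply: bigsetU_measurable => k _.
  rewrite !big_ord_recr/=; apply: le_trans (lerD ih (lexx _)).
  rewrite -(pfD _ _ pl); [|exact: essbdd_indic..].
  apply: (pf_le _ _ pl).
  - exact/essbdd_indic/measurableU.
  - by rewrite -[X in essbdd _ X]/(fun x => _ + _); under eq_fun do rewrite -[X in X + _]mul1r;
      apply: essbdd_lin; exact: essbdd_indic.
  apply: aeW => x; rewrite !indicE in_setU.
  by case: (x \in _); case: (x \in _); rewrite /= ?addr0 ?add0r// lerDl.
have sum_le (B : nat -> set T) N : (forall k, measurable (B k)) ->
    ((\sum_(k < N) L \1_(B k))%:E <= \sum_(0 <= k <oo) mu (B k))%E.
  move=> mB; apply: le_trans (nneseries_lim_ge N _) => //.
  rewrite big_mkord -sumEFin; apply: lee_sum => k _.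
  by rewrite muE.
exists nu; split => //.
- apply/null_content_dominatesP => A mA A0; apply/eqP; rewrite eq_le measure_ge0 andbT.
  by rewrite (le_trans (nu_le A mA))// (pf_indic_null _ _ pL).
- move=> l pl lcont lL A mA; rewrite nuE//.
  apply: le_ereal_inf_tmp => _ [B [mB AB] <-]; apply/lee_addgt0Pr => e e0.
  (* Off finitely many members of the cover [l] has mass at most [e]; on those members finite
     subadditivity compares it with [L]. *)
  have [eta eta0 etaP] := lcont _ e0.
  have [N mN] := cover_tail A B eta mA mB AB eta0.
  have mU : measurable (\big[setU/set0]_(k < N) B k).
    by apply: bigsetU_measurable => k _.
  apply: le_trans (leeD (sum_le B N mB) (lexx _)).
  rewrite -EFinD lee_fin (pf_indicID _ _ pl _ _ mA mU).
  apply: lerD; last by apply: etaP => //; exact: measurableD.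
  apply: (@le_trans _ _ (l \1_(\big[setU/set0]_(k < N) B k))).
    by apply: (pf_indic_le _ _ pl) => //; exact: measurableI.
  apply: (le_trans (pf_bigsetU _ _ _ pl mB)).
  by apply: ler_sum => k _; exact: lL.
- rewrite nuE// => nu0 e e0.
  (* There is a cover of total [L]-mass below [e]. Finitely many of its members fill the space up to
     [m]-measure [e], and their complement keeps all but [e] of the mass of [L]. *)
  have : (mu_ext mu setT < e%:E)%E by rewrite nu0 lte_fin.
  move=> /ereal_inf_lt[_ [B [mB AB] <-] Be].
  have [N mN] := cover_tail setT B e measurableT mB AB e0.
  have mU : measurable (\big[setU/set0]_(k < N) B k).
    by apply: bigsetU_measurable => k _.
  exists (setT `\` \big[setU/set0]_(k < N) B k); split => //.
    exact: measurableD.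
  rewrite -pf_indicT (pf_indicID _ _ pL _ _ measurableT mU) addrC lerD2l setTI.
  rewrite (le_trans (pf_bigsetU _ _ _ pL mB))// -lee_fin.
  by rewrite (le_trans (sum_le B N mB))// ltW.
Qed.

End countable_part.

(** * Semigroups on bounded functions and their averages *)

Section translation.
Context {R : realType}.
Local Notation leb := (@lebesgue_measure R).

Lemma lebesgue_measure_oc (a b : R) : a <= b ->
  leb (`]a, b]%classic : set R) = (b - a)%:E.
Proof.
move=> ab; rewrite [LHS]lebesgue_measure_itv/= lte_fin EFinB.
case: ltgtP ab => // -> _; by rewrite -EFinB subrr.
Qed.

(** After translation the two integrals differ by the pieces ]0,h] and ]t,t+h]; the first is dropped
    by nonnegativity, the second costs at most h C. *)
Lemma integral_shift_le (g : R -> R) (C t h : R) : measurable_fun setT g ->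
  (forall s, 0 <= g s <= C) -> 0 <= t -> 0 <= h ->
  (\int[leb]_(s in `]0%R, t]) (g (s + h)%R)%:E <=
   \int[leb]_(s in `]0%R, t]) (g s)%:E + (h * C)%:E)%E.
Proof.
move=> mg gC t0 h0.
have g0 s : (0 <= (g s)%:E)%E by rewrite lee_fin; have /andP[] := gC s.
have mEg (D : set R) : measurable D -> measurable_fun D (fun s => (g s)%:E).
  by move=> mD; apply/measurable_EFinP; exact: measurable_funTS.
pose phi := fun s : measurableTypeR R => (s + h : measurableTypeR R).
have mphi : measurable_fun setT phi by exact: measurable_funD.
have phiE a b : phi @^-1` `]a, b] = `]a - h, b - h]%classic.
  by apply/seteqP; split=> s /=; rewrite !in_itv/= /phi ltrBlDr lerBrDr.
(* Translation invariance from uniqueness: the pushforward also gives each half-open interval its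
   length. *)
have inv A : measurable A -> leb A = pushforward leb phi A.
  pose nu : {measure set (measurableTypeR R) -> \bar R} := pushforward leb phi.
  apply: (@lebesgue_measure_unique R (nu mphi)) => X [[a b] _ <-] /=.
  rewrite /pushforward phiE !lebesgue_measure_itv/= !lte_fin ltrD2r.
  by case: ifPn => // _; rewrite -!EFinB; congr EFin; ring.
have -> : (\int[leb]_(s in `]0%R, t]) (g (s + h)%R)%:E = \int[leb]_(s in `]h, (t + h)%R]) (g s)%:E)%E.
  rewrite [RHS](@eq_measure_integral _ _ _ _ (pushforward leb phi)); last first.
    by move=> A mA _; exact: inv.
  rewrite ge0_integral_pushforward//; last exact: mEg.
  by rewrite phiE subrr addrK.
have tU : `]0, (t + h)%R]%classic = `]0, t] `|` `]t, (t + h)%R] :> set R.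
  rewrite -itv_bndbnd_setU// ?bnd_simp//.
  by rewrite lerDl.
apply: (@le_trans _ _ (\int[leb]_(s in `]0%R, (t + h)%R]) (g s)%:E)%E).
  apply: ge0_subset_integral => //; first exact: mEg.
  by move=> s /=; rewrite !in_itv/= => /andP[/(le_lt_trans h0) -> ->].
rewrite tU ge0_integral_setU//; last 2 first.
- by apply: mEg; exact: measurableU.
- apply/disj_setPS => s [] /=; rewrite !in_itv/= => /andP[_ st] /andP[ts _].
  by move: (lt_le_trans ts st); rewrite ltxx.
rewrite leeD2l//.
apply: (@le_trans _ _ (\int[leb]_(s in `]t, (t + h)%R]) C%:E)%E).
  apply: ge0_le_integral => //.
  - exact: mEg.
  - by move=> s _; rewrite lee_fin; have /andP[] := gC s.
rewrite integral_cst// [X in (_ * X)%E]lebesgue_measure_oc ?lerDl//.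
by rewrite addrAC subrr add0r -EFinM mulrC.
Qed.

End translation.

Section semigroup.
Context {d : measure_display} {T : measurableType d} {R : realType}.
Variable m : {finite_measure set T -> \bar R}.

(* What the two settings of the theorem have in common; operators act on
   representatives and identities hold [m]-almost everywhere, for [t > 0] only. *)
Record Linf_semigroup (P : @opfam d T R) : Prop := LinfSemigroup {
  sg_stable : forall (t : R) (f : T -> R), 0 < t -> essbdd m f -> essbdd m (P t f);
  sg_lin : forall (t a : R) (f g : T -> R), 0 < t -> essbdd m f -> essbdd m g ->
    aeeq m (P t (fun x => a * f x + g x)) (fun x => a * P t f x + P t g x);
  sg_ge0 : forall (t : R) (f : T -> R), 0 < t -> essbdd m f -> {ae m, forall x, 0 <= f x} ->
    {ae m, forall x, 0 <= P t f x};
  sg_one : forall t : R, 0 < t -> aeeq m (P t (cst 1)) (cst 1);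
  sg_comp : forall (t s : R) (f : T -> R), 0 < t -> 0 < s -> essbdd m f ->
    aeeq m (P (t + s) f) (P t (P s f));
  sg_meas : forall f : T -> R, essbdd m f ->
    measurable_fun (`]0, +oo[%classic : set R) (fun t : R => \int[m]_x P t f x);
  sg_cont : forall t e : R, 0 < t -> 0 < e -> exists2 eta : R, 0 < eta &
    forall A, measurable A -> (m A <= eta%:E)%E -> \int[m]_x P t \1_A x <= e }.

Variable P : @opfam d T R.
Hypothesis sgP : Linf_semigroup P.
Let c := fine (m setT).

Lemma pf_sg Phi t : pos_functional m Phi -> 0 < t ->
  pos_functional m (fun f => Phi (P t f)).
Proof.
move=> pPhi t0; split=> [a f g bf bg|f bf f0].
  have bPf := sg_stable _ sgP t f t0 bf; have bPg := sg_stable _ sgP t g t0 bg.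
  rewrite -(pf_lin _ _ pPhi)//; apply: (pf_ae_eq _ _ pPhi).
  - exact/(sg_stable _ sgP)/essbdd_lin.
  - exact: essbdd_lin.
  - exact: (sg_lin _ sgP).
by apply: (pf_ge0 _ _ pPhi); [exact: (sg_stable _ sgP)|exact: (sg_ge0 _ sgP)].
Qed.

Lemma pf_sg_one Phi t : pos_functional m Phi -> 0 < t ->
  Phi (P t (cst 1)) = Phi (cst 1).
Proof.
move=> pPhi t0; apply: (pf_ae_eq _ _ pPhi); last exact: (sg_one _ sgP).
- by apply: (sg_stable _ sgP) => //; exact: essbdd_cst.
- exact: essbdd_cst.
Qed.

Lemma sg_01 t f : 0 < t -> essbdd m f -> {ae m, forall x, 0 <= f x <= 1} ->
  {ae m, forall x, 0 <= P t f x <= 1}.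
Proof.
move=> t0 bf f01; have b1 := essbdd_cst m 1.
have P0 : {ae m, forall x, 0 <= P t f x}.
  by apply: (sg_ge0 _ sgP) => //; apply: filterS f01 => x /andP[].
have P1 : {ae m, forall x, 0 <= P t (fun x => -1 * f x + cst 1 x) x}.
  apply: (sg_ge0 _ sgP) => //; first exact: essbdd_lin.
  by apply: filterS f01 => x /andP[_]; rewrite mulN1r addrC subr_ge0.
have := sg_lin _ sgP t (-1) f (cst 1) t0 bf b1.
apply: filterS3 (filterI P0 P1) (sg_one _ sgP t t0).
move=> x [-> +] -> => /[swap] ->.
by rewrite mulN1r addrC subr_ge0.
Qed.

(* The null extension to [s <= 0] makes [s |-> sgint s f] measurable on the
   whole line; nothing is assumed about [P 0]. *)
Definition sgint (s : R) (f : T -> R) := if 0 < s then \int[m]_x P s f x else 0.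

Lemma sgintE s f : 0 < s -> sgint s f = \int[m]_x P s f x.
Proof. by rewrite /sgint => ->. Qed.

Lemma pf_sgint s : 0 < s -> pos_functional m (sgint s).
Proof.
move=> s0; rewrite /sgint s0.
exact: (pf_sg (fun f => \int[m]_x f x) s (pf_Rintegral m m (fun _ => id)) s0).
Qed.

Lemma measurable_sgint f : essbdd m f -> measurable_fun setT (sgint ^~ f).
Proof.
move=> bf; have mI : measurable (`]0, +oo[%classic : set R) by [].
have -> : sgint ^~ f = (fun t => \int[m]_x P t f x) \_ `]0, +oo[.
  apply/funext => s; rewrite patchE /sgint mem_setE in_itv/= andbT.
  by case: ifP.
by apply: (measurable_restrictT _ mI).1; exact: (sg_meas _ sgP f bf).
Qed.

Lemma Rintegral_cst1 : \int[m]_x (cst 1 x : R) = c.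
Proof. by rewrite Rintegral_cst// mul1r. Qed.

Lemma sgint_one s : 0 < s -> sgint s (cst 1) = c.
Proof.
move=> s0; rewrite sgintE// -Rintegral_cst1.
by rewrite (pf_sg_one (fun f => \int[m]_x f x) s (pf_Rintegral m m (fun _ => id)) s0).
Qed.

Lemma mass_ge0 : 0 <= c. Proof. by rewrite /c fine_ge0. Qed.

Lemma sgint_norm_le s f M : essbdd m f -> {ae m, forall x, `|f x| <= M} ->
  `|sgint s f| <= `|M| * c.
Proof.
move=> bf fM; have [s0|s0] := ltP 0 s.
  by rewrite -(sgint_one s s0) (pf_norm_le _ _ (pf_sgint s s0)).
by rewrite /sgint ltNge s0 normr0 mulr_ge0// mass_ge0.
Qed.

Lemma sgint_integrable f t : essbdd m f ->
  lebesgue_measure.-integrable `]0, t] (EFin \o (sgint ^~ f)).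
Proof.
move=> bf; have [_ [M fM]] := bf.
apply: measurable_bounded_integrable => //.
- by rewrite [X in (X < _)%E]lebesgue_measure_itv/=; case: ifP; rewrite ?ltry.
- apply: measurable_funTS; exact: measurable_sgint.
- exists (`|M| * c); split; first exact: num_real.
  by move=> x Mx s _ /=; rewrite (le_trans (sgint_norm_le s f M bf fM))// ltW.
Qed.

Definition sgavg (t : R) (f : T -> R) := t^-1 * \int[lebesgue_measure]_(s in `]0, t]) sgint s f.

Lemma pf_sgavg t : 0 < t -> pos_functional m (sgavg t).
Proof.
move=> t0; split=> [a f g bf bg|f bf f0].
  have If := sgint_integrable f t bf; have Ig := sgint_integrable g t bg.
  rewrite /sgavg mulrCA -mulrDr; congr (_ * _).
  rewrite -RintegralZl// -RintegralD//; last exact: (integrableZl _ a If).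
  apply: eq_Rintegral => s; rewrite inE/= in_itv/= => /andP[s0 _].
  by rewrite (pf_lin _ _ (pf_sgint s s0)).
rewrite mulr_ge0 ?invr_ge0 ?(ltW t0)//; apply: Rintegral_ge0 => s /=.
by rewrite in_itv/= => /andP[s0 _]; exact: (pf_ge0 _ _ (pf_sgint s s0)).
Qed.

Lemma sgavg_one t : 0 < t -> sgavg t (cst 1) = c.
Proof.
move=> t0; rewrite /sgavg; under eq_Rintegral.
  move=> s; rewrite inE/= in_itv/= => /andP[s0 _].
  rewrite sgint_one//; over.
rewrite Rintegral_cst// [X in fine X]lebesgue_measure_oc ?ltW// subr0/=.
by rewrite mulrCA mulVf ?mulr1// gt_eqF.
Qed.

Lemma essbdd_indic01 A : {ae m, forall x, 0 <= (\1_A x : R) <= 1}.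
Proof. by apply: aeW => x; rewrite indicE; case: (_ \in _); rewrite ?lexx ?ler01. Qed.

Lemma mPE s A : 0 < s -> measurable A -> mP m P s A = (sgint s \1_A)%:E.
Proof.
move=> s0 mA; rewrite sgintE// /mP /Rintegral fineK//.
apply: integrable_fin_num => //; apply: essbdd_integrable.
by apply: (sg_stable _ sgP) => //; exact: essbdd_indic.
Qed.

(** [tavg] integrates over a closed interval, while [Linf_semigroup] speaks of positive times only.
    The endpoint 0 is Lebesgue-null and can be removed once the integrand is known to be measurable
    on the rest. *)
Lemma tavgE t A : 0 < t -> measurable A -> tavg m P t A = (sgavg t \1_A)%:E.
Proof.
move=> t0 mA; have bA := essbdd_indic m A mA.
have It := sgint_integrable _ t bA.
have mPi : {in `]0, t]%classic, forall s, mP m P s A = (sgint s \1_A)%:E}.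
  by move=> s; rewrite inE/= in_itv/= => /andP[s0 _]; exact: mPE.
rewrite /tavg /sgavg EFinM; congr (_ * _)%E.
rewrite -integral_itv_obnd_cbnd; last first.
  apply: (eq_measurable_fun (EFin \o (sgint ^~ (\1_A : T -> R)))).
    by move=> s /mPi ->.
  apply/measurable_EFinP; apply: measurable_funTS.
  exact: measurable_sgint.
rewrite (eq_integral (fun s : measurableTypeR R => (sgint s \1_A)%:E))//.
by rewrite /Rintegral fineK//; exact: integrable_fin_num.
Qed.

(** By P_s P_h = P_(s+h), applying [P h] translates the integrand in time. The error h c / t
    vanishes as t grows, which makes the limit functional decrease under [P h]. *)
Lemma sgavg_shift t h f : 0 < t -> 0 < h -> essbdd m f ->
  {ae m, forall x, 0 <= f x <= 1} ->
  sgavg t (P h f) <= sgavg t f + t^-1 * (h * c).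
Proof.
move=> t0 h0 bf f01.
have bPf := sg_stable _ sgP h f h0 bf.
rewrite /sgavg -mulrDr ler_pM2l ?invr_gt0// -lee_fin EFinD.
have fn g : essbdd m g ->
    (\int[lebesgue_measure]_(s in `]0%R, t]) (sgint s g)%:E)%E \is a fin_num.
  by move=> bg; have := sgint_integrable g t bg; exact: integrable_fin_num.
rewrite /Rintegral !fineK//; [|exact: fn..].
rewrite (eq_integral (fun s : measurableTypeR R => (sgint (s + h) f)%:E)); last first.
  move=> s; rewrite inE/= in_itv/= => /andP[s0 _].
  rewrite sgintE// sgintE ?addr_gt0//; congr EFin.
  apply: (pf_ae_eq _ _ (pf_Rintegral m m (fun _ => id))).
  - exact: (sg_stable _ sgP).
  - by apply: (sg_stable _ sgP) => //; rewrite addr_gt0.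
  - by apply: filterS (sg_comp _ sgP s h f s0 h0 bf) => x ->.
apply: integral_shift_le; [exact: measurable_sgint| |exact: ltW..].
move=> s; have [s0|s0] := ltP 0 s; last by rewrite /sgint ltNge s0/= lexx mass_ge0.
apply/andP; split.
  by apply: (pf_ge0 _ _ (pf_sgint s s0)) => //; apply: filterS f01 => x /andP[].
rewrite -(sgint_one s s0); apply: (pf_le _ _ (pf_sgint s s0)) => //.
  exact: essbdd_cst.
by apply: filterS f01 => x /andP[].
Qed.

End semigroup.

(** * Invariant measures *)

Section absolute_continuity.
Context {d : measure_display} {T : measurableType d} {R : realType}.
Variables m nu : {finite_measure set T -> \bar R}.
Hypothesis num : nu `<< m.

Lemma exists_density : exists2 rho : T -> R, m.-integrable setT (EFin \o rho) &
  forall A, measurable A -> nu A = (\int[m]_(x in A) (rho x)%:E)%E.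
Proof.
pose f := Radon_Nikodym (charge_of_finite_measure nu) m.
have fE : EFin \o (fine \o f) = f.
  by apply/funext => x; rewrite /= fineK//; exact: Radon_Nikodym_fin_num.
exists (fine \o f); first by rewrite fE; exact: Radon_Nikodym_integrable.
move=> A mA; rewrite -[X in integral _ _ X]/(EFin \o (fine \o f)) fE.
exact: (@Radon_Nikodym_integral _ _ _ (charge_of_finite_measure nu) m A num mA).
Qed.

(** Domination of null sets becomes an epsilon-eta statement through the density and the absolute
    continuity of its integral; finiteness of [nu] makes this possible. *)
Lemma dominates_continuous (e : R) : 0 < e -> exists2 eta : R, 0 < eta &
  forall A, measurable A -> (m A <= eta%:E)%E -> (nu A <= e%:E)%E.
Proof.
move=> e0; have [rho irho rhoE] := exists_density.
have [eta [eta0 etaP]] := integral_normr_continuous irho e0.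
exists (eta / 2); first by rewrite divr_gt0.
move=> A mA Aeta; have iA := integrableS measurableT mA (@subsetT _ A) irho.
have /etaP/ltW rhoA : (m A < eta%:E)%E.
  by rewrite (le_lt_trans Aeta)// lte_fin ltr_pdivrMr// mulr_natr mulr2n ltrDl.
have := le_trans (le_normr_Rintegral mA iA) (rhoA mA).
rewrite -lee_fin EFin_normr_Rintegral// -rhoE//.
by rewrite gee0_abs.
Qed.

(** [B] is the set where the density is at least [c]. If it were [m]-null it would be [nu]-null, and
    the total mass of [nu] would be at most c m(E). *)
Lemma exists_dominated_set : nu setT != 0%E -> exists (B : set T) (c : R),
  [/\ measurable B, 0 < c, (m B != 0)%E &
    forall A, measurable A -> (c%:E * m (A `&` B) <= nu A)%E].
Proof.
move=> nuT0; have [rho irho rhoE] := exists_density.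
have mT_fin : m setT \is a fin_num by exact: fin_num_measure.
have nT_fin : nu setT \is a fin_num by exact: fin_num_measure.
have nT : 0 < fine (nu setT).
  by rewrite fine_gt0// lt0e nuT0 measure_ge0 ltey_eq nT_fin.
have mT : 0 <= fine (m setT) by rewrite fine_ge0.
(* Chosen so that c m(E) < nu(E); the summand 1 keeps the denominator positive. *)
pose c := fine (nu setT) / (2 * (fine (m setT) + 1)).
have c0 : 0 < c by rewrite divr_gt0// mulr_gt0// ltr_pwDr.
have mrho : measurable_fun setT rho.
  by have /integrableP[/measurable_EFinP] := irho.
pose B := [set x | c <= rho x].
have mB : measurable B.
  rewrite -[B]setTI; apply: measurable_fun_le => //; exact: measurable_cst.
have iS A : measurable A -> m.-integrable A (EFin \o rho).
  by move=> mA; exact: (integrableS measurableT mA (@subsetT _ A) irho).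
have iC A : measurable A -> m.-integrable A (EFin \o cst c).
  by move=> mA; exact: finite_measure_integrable_cst.
exists B, c; split => //; last first.
  move=> A mA; have mAB : measurable (A `&` B) by exact: measurableI.
  apply: (@le_trans _ _ (nu (A `&` B))); last first.
    by rewrite le_measure// ?inE//; exact: subIsetl.
  rewrite -integral_cst// rhoE//; apply: le_integral => //.
  - exact: iC.
  - exact: iS.
  - by move=> x; rewrite inE => -[_ /=]; rewrite lee_fin.
apply/negP => /eqP mB0.
have nuB0 : nu B = 0%E by have /null_content_dominatesP := num; apply.
have mCB : measurable (~` B) by exact: measurableC.
have nuE : nu setT = nu (~` B).
  by rewrite -(setvU B) measureU ?setICl// [X in (_ + X)%E]nuB0 adde0.
have : (nu setT <= c%:E * m setT)%E.
  rewrite nuE rhoE//; apply: (@le_trans _ _ (c%:E * m (~` B))%E).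
    rewrite -integral_cst//; apply: le_integral => //.
    - exact: iS.
    - exact: iC.
    - by move=> x; rewrite inE lee_fin => /= /negP; rewrite -ltNge => /ltW.
  by rewrite lee_wpmul2l ?lee_fin ?(ltW c0)// le_measure ?inE.
rewrite -(fineK nT_fin) -(fineK mT_fin) -EFinM lee_fin leNgt => /negP; apply.
rewrite /c mulrAC ltr_pdivrMr ?mulr_gt0 ?ltr_pwDr// ltr_pM2l//.
by lra.
Qed.

End absolute_continuity.

Section functional_operations.
Context {d : measure_display} {T : measurableType d} {R : realType}.
Variable m : {finite_measure set T -> \bar R}.

Lemma pf_addZ Phi Psi (a : R) : 0 <= a -> pos_functional m Phi ->
  pos_functional m Psi -> pos_functional m (fun f => Phi f + a * Psi f).
Proof.
move=> a0 pPhi pPsi; split=> [b f g bf bg|f bf f0].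
  by rewrite (pf_lin _ _ pPhi)// (pf_lin _ _ pPsi)//; ring.
by rewrite addr_ge0 ?mulr_ge0//; [exact: (pf_ge0 _ _ pPhi)|exact: (pf_ge0 _ _ pPsi)].
Qed.

Lemma essbdd_restrict (f : T -> R) B : measurable B -> essbdd m f ->
  essbdd m (f \_ B).
Proof.
move=> mB [mf [M fM]]; split.
  by apply: (measurable_restrictT _ mB).1; exact: measurable_funTS.
exists `|M|; apply: filterS fM => x fM; rewrite patchE.
by case: ifP => _; rewrite ?normr0// (le_trans fM)// ler_norm.
Qed.

Lemma pf_restrict Phi B : measurable B -> pos_functional m Phi ->
  pos_functional m (fun f => Phi (f \_ B)).
Proof.
move=> mB pPhi; split=> [a f g bf bg|f bf f0].
  rewrite -(pf_lin _ _ pPhi); [|exact: essbdd_restrict..].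
  congr Phi; apply/funext => x; rewrite !patchE.
  by case: ifP => // _; rewrite mulr0 addr0.
apply: (pf_ge0 _ _ pPhi); first exact: essbdd_restrict.
by apply: filterS f0 => x; rewrite patchE; case: ifP.
Qed.

Lemma restrict_indic A B : (\1_A : T -> R) \_ B = \1_(A `&` B).
Proof.
apply/funext => x; rewrite patchE !indicE in_setI.
by case: (x \in B); rewrite ?andbT ?andbF.
Qed.

End functional_operations.

(** * Invariance implies almost invariance; a gap in the averages yields an invariant measure *)

Section invariant_measures.
Context {d : measure_display} {T : measurableType d} {R : realType}.
Variables (m : {finite_measure set T -> \bar R}) (P : @opfam d T R).
Hypothesis sgP : Linf_semigroup m P.
Let c := fine (m setT).

Let mE : m setT = c%:E. Proof. by rewrite fineK// fin_num_measure. Qed.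

Lemma invariant_almost_invariant (nu : {finite_measure set T -> \bar R}) :
  (0 < m setT)%E -> nu `<< m -> invariant_measure P nu -> almost_invariant m P.
Proof.
move=> mT0 num [nuT0 nuP].
have c0 : 0 < c by rewrite -lte_fin -mE.
have [B [k [mB k0 mB0 kB]]] := exists_dominated_set m nu num nuT0.
have mCB : measurable (~` B) by exact: measurableC.
have mfin A : measurable A -> m A = (fine (m A))%:E.
  by move=> mA; rewrite fineK// fin_num_measure.
have nfin A : measurable A -> nu A = (fine (nu A))%:E.
  by move=> mA; rewrite fineK// fin_num_measure.
have mBpos : 0 < fine (m B).
  by rewrite fine_gt0// lt0e mB0 measure_ge0 -ge0_fin_numE// fin_num_measure.
have mTE : c = fine (m (~` B)) + fine (m B).
  by apply: EFin_inj; rewrite EFinD -!mfin// -(setvU B) measureU// setICl.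
have pm : pos_functional m (fun f => \int[m]_x f x) by exact: pf_Rintegral.
have pnu : pos_functional m (fun f => \int[nu]_x f x) by exact: pf_Rintegral.
(* Then delta m(E) = m(~B), and delta < 1 because m(B) > 0. *)
exists (fine (m (~` B)) / c), (fun A => k^-1 * fine (nu A)); split.
- apply/andP; split; first by rewrite divr_ge0 ?fine_ge0// ltW.
  by rewrite ltr_pdivrMr// mul1r mTE ltrDl.
- by move=> A; apply: mulr_ge0; rewrite ?fine_ge0// invr_ge0 ltW.
- move=> e e0; have [eta eta0 etaP] := dominates_continuous m nu num (k * e) (mulr_gt0 k0 e0).
  exists eta => // A mA /(etaP A mA); rewrite nfin// lee_fin => nuA.
  by rewrite mulrC ler_pdivrMr// mulrC.
move=> t A t0 mA; rewrite (mPE m P sgP)// sgintE// [X in (_ * X + _)%E]mE -EFinM mulfVK ?gt_eqF//.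
rewrite -EFinD lee_fin.
have bA := essbdd_indic m A mA.
have b1 := essbdd_cst m 1.
have bPA := sg_stable _ _ sgP t \1_A t0 bA.
have PA01 := sg_01 m P sgP t \1_A t0 bA (essbdd_indic01 m A).
have nuPA : \int[nu]_x P t \1_A x = fine (nu A).
  rewrite /Rintegral nuP//; first by rewrite integral_indic// setIT.
  by exists 1 => x; rewrite indicE; case: (_ \in _); rewrite ?normr1 ?normr0.
(* On sets, m(D) <= m(D \ B) + nu(D) / k. Read as a comparison of functionals, this applies to
   [P t \1_A]; then P_t 1_A <= 1 bounds the first term and invariance evaluates the second. *)
pose Psi f := \int[m]_x (f \_ (~` B)) x + k^-1 * \int[nu]_x f x.
have kV0 : 0 <= k^-1 by rewrite invr_ge0 ltW.
have pPsi : pos_functional m Psi.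
  exact: (pf_addZ m (fun f => \int[m]_x (f \_ (~` B)) x) _ _ kV0
    (pf_restrict m (fun f => \int[m]_x f x) _ mCB pm) pnu).
apply: (@le_trans _ _ (Psi (P t \1_A))).
  apply: (pf_le_of_indic m (fun f => \int[m]_x f x) Psi) => // D mD.
  rewrite (pf_indicID m _ pm D (~` B) mD mCB) /Psi restrict_indic lerD2l.
  rewrite setDE setCK ler_pdivlMl// -lee_fin EFinM !EFin_Rintegral_indic//.
    exact: kB.
  exact: measurableI.
rewrite /Psi nuPA lerD2r.
apply: (@le_trans _ _ (\int[m]_x (((cst 1 : T -> R) \_ (~` B)) x))).
  apply: (pf_le _ _ (pf_restrict m (fun f => \int[m]_x f x) _ mCB pm)) => //.
  by apply: filterS PA01 => x /andP[].
rewrite -Rintegral_mkcond Rintegral_cst// mul1r.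
by [].
Qed.

Lemma invariant_of_gap (tn : nat -> R) (eps c0 : R) : (forall n, 0 < tn n) ->
  tn n @[n --> \oo] --> +oo -> 0 < eps -> c0 < c ->
  (forall n A, measurable A -> (m A <= eps%:E)%E ->
    sgavg m P (tn n) \1_A <= c0) ->
  exists nu : {finite_measure set T -> \bar R}, nu `<< m /\ invariant_measure P nu.
Proof.
move=> tn0 tnoo eps0 c0c gap.
have pm : pos_functional m (fun f => \int[m]_x f x) by exact: pf_Rintegral.
have b1 := essbdd_cst m 1.
have pAv n := pf_sgavg m P sgP (tn n) (tn0 n).
have Av1 n : sgavg m P (tn n) (cst 1) = c by exact: sgavg_one.
have [|L pL LP] := exists_ultralimit m (fun n => sgavg m P (tn n)) pAv c.
  by move=> n; rewrite Av1.
(* [LP] transfers upper bounds only, so the lower bound on the mass is obtained from the function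
   -1. *)
have L1 : c <= L (cst 1).
  have := LP (fun x => -1 * cst 1 x) (- c) (essbddZ _ _ _ b1).
  rewrite (pfZ _ _ pL)// mulN1r lerN2; apply => e e0; apply: nearW => n.
  by rewrite (pfZ _ _ (pAv n))// Av1 mulN1r lerDl ltW.
have [nu [num nuL numax nu0]] := exists_countable_part m L pL.
have pnu : pos_functional m (fun f => \int[nu]_x f x) by exact: pf_Rintegral.
have LPh h A : 0 < h -> measurable A -> L (P h \1_A) <= L \1_A.
  move=> h0 mA; have bA := essbdd_indic m A mA.
  have bPA := sg_stable _ _ sgP h \1_A h0 bA.
  rewrite -subr_le0 -(pfB _ _ pL)//; apply: LP; first exact: essbddB.
  move=> e e0; near=> n; rewrite add0r (pfB _ _ (pAv n))//.
  rewrite lerBlDl (le_trans (sgavg_shift m P sgP _ _ _ (tn0 n) h0 bA (essbdd_indic01 m A)))//.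
  rewrite lerD2l mulrC ler_pdivrMr// -ler_pdivrMl//.
  by near: n; exact: (cvgry_ge tnoo).
have nuPh h : 0 < h -> forall A, measurable A -> ((\int[nu]_x P h \1_A x)%:E <= nu A)%E.
  move=> h0; apply: (numax (fun f => \int[nu]_x P h f x)).
  - exact: (pf_sg m P sgP (fun f => \int[nu]_x f x)).
  (* Chebyshev's inequality: let B be the set where P_h 1_A >= e1. Then e1 m(B) <= m(P_h 1_A) <= e1
     eta1, so nu(B) <= e/2, while P_h 1_A <= e1 + 1_B and e1 nu(E) <= e/2. *)
  - move=> e e0; pose k := fine (nu setT) + 1.
    have k0 : 0 < k by rewrite ltr_pwDr// fine_ge0.
    have e20 : 0 < e / 2 by rewrite divr_gt0.
    have [eta1 eta10 eta1P] := dominates_continuous m nu num _ e20.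
    pose e1 := e / 2 / k; have e10 : 0 < e1 by rewrite divr_gt0.
    have [eta eta0 etaP] := sg_cont _ _ sgP h _ h0 (mulr_gt0 e10 eta10).
    exists eta => // A mA Aeta; have bA := essbdd_indic m A mA.
    have bPA := sg_stable _ _ sgP h \1_A h0 bA.
    have PA01 := sg_01 m P sgP h \1_A h0 bA (essbdd_indic01 m A).
    pose B := [set x | e1 <= P h \1_A x].
    have mB : measurable B.
      rewrite -[B]setTI; apply: measurable_fun_le => //.
      exact: bPA.1.
    have bB := essbdd_indic m B mB.
    have /(eta1P B mB) : (m B <= eta1%:E)%E.
      rewrite -EFin_Rintegral_indic// lee_fin -(ler_pM2l e10).
      rewrite (le_trans _ (etaP A mA Aeta))// -(pfZ _ _ pm)//.
      apply: (pf_le _ _ pm) => //; first exact: essbddZ.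
      apply: filterS PA01 => x /andP[PA0 _]; rewrite indicE.
      by have [xB|xB] := pselect (B x); rewrite ?(mem_set xB) ?(memNset xB) ?mulr1 ?mulr0.
    rewrite -EFin_Rintegral_indic// lee_fin => nuB.
    apply: (@le_trans _ _ (\int[nu]_x (e1 * cst 1 x + \1_B x))).
      apply: (pf_le _ _ pnu) => //; first exact: essbdd_lin.
      apply: filterS PA01 => x /andP[_ PA1]; rewrite indicE /= mulr1.
      have [xB|xB] := pselect (B x).
        by rewrite (mem_set xB) (le_trans PA1)// lerDr ltW.
      by rewrite (memNset xB) addr0 ltW// ltNge; apply/negP.
    rewrite (pf_lin _ _ pnu)// [leRHS]splitr lerD// Rintegral_cst// mul1r.
    rewrite /e1 mulrAC ler_pdivrMr// ler_pM2l//.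
    by rewrite /k lerDl.
  (* The inequality between [nu] and [L] on sets passes to [P h \1_A] by the layer-cake
     comparison. *)
  - move=> A mA; have bA := essbdd_indic m A mA.
    apply: (le_trans _ (LPh h A h0 mA)).
    apply: (pf_le_of_indic m (fun f => \int[nu]_x f x) L) => //.
    + by move=> D mD; rewrite -lee_fin EFin_Rintegral_indic//; exact: nuL.
    + exact: (sg_stable _ _ sgP).
    + exact: (sg_01 m P sgP h \1_A h0 bA (essbdd_indic01 m A)).
(* Both [A] and its complement satisfy the inequality and the totals agree, so neither can be
   strict. *)
have nuPhE h A : 0 < h -> measurable A -> \int[nu]_x P h \1_A x = \int[nu]_x (\1_A x : R).
  move=> h0 mA; have mCA := measurableC mA.
  have pnuh := pf_sg m P sgP (fun f => \int[nu]_x f x) h pnu h0.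
  have le1 D (mD : measurable D) : \int[nu]_x P h \1_D x <= \int[nu]_x (\1_D x : R).
    by rewrite -lee_fin EFin_Rintegral_indic//; exact: nuPh.
  have := pf_sg_one m P sgP (fun f => \int[nu]_x f x) h pnu h0.
  rewrite -(pf_indicT (fun f => \int[nu]_x f x)) -(pf_indicT (fun f => \int[nu]_x P h f x)).
  rewrite (pf_indicID m _ pnu _ A measurableT mA) (pf_indicID m _ pnuh _ A measurableT mA).
  rewrite setTI setTD => eqT.
  by have := le1 _ mA; have := le1 _ mCA; lra.
exists nu; split => //; split.
  apply/eqP => /nu0 nuT.
  (* If [nu] vanished, a set of [m]-measure at most [eps] would carry at least c - (c - c0) / 2 > c0
     of [L], whereas the uniform bound passes to the limit and gives at most [c0]. *)
  have e0 : 0 < Num.min eps ((c - c0) / 2) by rewrite lt_min eps0 divr_gt0// subr_gt0.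
  have [A [mA Ae LA]] := nuT _ e0.
  have LAc0 : L \1_A <= c0.
    apply: LP; first exact: essbdd_indic.
    move=> e ee; apply: nearW => n.
    rewrite (le_trans (gap n A mA _)) ?lerDl ?(ltW ee)//.
    by rewrite (le_trans Ae)// lee_fin ge_min lexx.
  have : Num.min eps ((c - c0) / 2) <= (c - c0) / 2 by rewrite ge_min lexx orbT.
  by move: LA L1 c0c LAc0; lra.
move=> t f t0 mf [M fM].
have bf : essbdd m f by split => //; exists M; exact: aeW.
have bPf := sg_stable _ _ sgP t f t0 bf.
have pnut := pf_sg m P sgP (fun f => \int[nu]_x f x) t pnu t0.
have : \int[nu]_x P t f x = \int[nu]_x f x.
  apply: (pf_eq_of_indic m (fun f => \int[nu]_x P t f x) (fun f => \int[nu]_x f x)) => // A mA.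
  exact: nuPhE.
have fin g : essbdd m g -> (\int[nu]_x (g x)%:E)%E \is a fin_num.
  move=> bg; have := essbdd_integrable _ _ (essbdd_dominates m nu g num bg).
  exact: integrable_fin_num.
by move=> eqf; rewrite -(fineK (fin _ bPf)) -(fineK (fin _ bf)); congr EFin.
Unshelve. all: by end_near. Qed.

End invariant_measures.

(** * The cycle of implications in the common framework *)

Section equivalence.
Context {d : measure_display} {T : measurableType d} {R : realType}.
Variables (m : {finite_measure set T -> \bar R}) (P : @opfam d T R).

(** The supremum is nondecreasing in [eps], so the limit at 0 from the right is the infimum over
    positive [eps]. *)
Lemma cconst_lt tn (x : \bar R) :
  (cconst m P tn < x)%E <-> exists2 eps : R, 0 < eps & (csup m P tn eps < x)%E.
Proof.
have ndcsup : {homo csup m P tn : a b / (a <= b)%R >-> (a <= b)%E}.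
  move=> a b ab; apply: ge_ereal_sup => _ [n _ [A [mA Aa] <-]].
  apply: ereal_sup_ubound; exists n => //; exists A => //; split => //.
  by rewrite (le_trans Aa).
have cE : cconst m P tn = ereal_inf (csup m P tn @` `]0, +oo[%classic).
  apply: cvg_lim; first exact: ereal_hausdorff.
  apply: nondecreasing_at_right_cvge => //.
  by move=> a b _ _; exact: ndcsup.
rewrite cE; split.
  move=> /ereal_inf_lt[_ [eps /= + <-]]; rewrite in_itv/= andbT => eps0 epsx.
  by exists eps.
move=> [eps eps0]; apply: le_lt_trans; apply: ereal_inf_lbound.
by exists eps => //=; rewrite in_itv/= andbT.
Qed.

Hypothesis sgP : Linf_semigroup m P.
Hypothesis mT0 : (0 < m setT)%E.
Let c := fine (m setT).
Let mE : m setT = c%:E. Proof. by rewrite fineK// fin_num_measure. Qed.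

Lemma almost_invariant_mean tn : (forall n, 0 < tn n) ->
  almost_invariant m P -> mean_almost_invariant m P tn.
Proof.
move=> tn0 [delta [phi [d01 phi0 phiv ai]]]; exists delta, phi; split => // n A mA.
rewrite (tavgE m P sgP)// [X in (_ * X + _)%E]mE -EFinM -EFinD lee_fin.
have bA := essbdd_indic m A mA; have IA := sgint_integrable m P sgP _ (tn n) bA.
rewrite /sgavg ler_pdivrMl// mulrC.
apply: (@le_trans _ _ (\int[lebesgue_measure]_(s in `]0, tn n]) cst (delta * c + phi A) s)).
  apply: le_Rintegral => //.
    apply: measurable_bounded_integrable => //.
    - by rewrite [X in (X < _)%E]lebesgue_measure_oc ?ltry ?ltW.
    - exists `|delta * c + phi A|; split; first exact: num_real.
      by move=> x Mx s _; exact: ltW.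
  move=> s /=; rewrite in_itv/= => /andP[s0 _].
  by have := ai s A s0 mA; rewrite (mPE m P sgP)// [X in (_ * X + _)%E]mE -EFinM -EFinD lee_fin.
by rewrite Rintegral_cst// [X in fine X]lebesgue_measure_oc ?subr0// ltW.
Qed.

Lemma mean_almost_invariant_cconst tn : mean_almost_invariant m P tn ->
  (cconst m P tn < m setT)%E.
Proof.
move=> [delta [phi [/andP[d0 d1] phi0 phiv ai]]].
have c0 : 0 < c by rewrite -lte_fin -mE.
(* Half the gap between delta m(E) and m(E). *)
have e0 : 0 < (1 - delta) * c / 2 by rewrite divr_gt0// mulr_gt0// subr_gt0.
have [eta eta0 etaP] := phiv _ e0.
apply/cconst_lt; exists eta => //.
apply: (@le_lt_trans _ _ (delta * c + (1 - delta) * c / 2)%:E).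
  apply: ge_ereal_sup => _ [n _ [A [mA Aeta] <-]].
  rewrite (le_trans (ai n A mA))// [X in (_ * X + _)%E]mE -EFinM -EFinD lee_fin lerD2l.
  exact: etaP.
by rewrite mE lte_fin; nra.
Qed.

Lemma cconst_invariant tn : increasing_to_infty tn -> (cconst m P tn < m setT)%E ->
  exists nu : {finite_measure set T -> \bar R}, nu `<< m /\ invariant_measure P nu.
Proof.
move=> [tn0 _ tnoo] /cconst_lt[eps eps0 csc].
have cs n A : measurable A -> (m A <= eps%:E)%E ->
    ((sgavg m P (tn n) \1_A)%:E <= csup m P tn eps)%E.
  move=> mA Aeps; rewrite -(tavgE m P sgP)//; apply: ereal_sup_ubound.
  by exists n => //; exists A.
have csfin : csup m P tn eps \is a fin_num.
  apply/fin_numPlt/andP; split.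
    rewrite (lt_le_trans _ (cs 0%N set0 measurable0 _)) ?ltNyr//.
    by rewrite measure0 lee_fin ltW.
  by rewrite (lt_trans csc)// mE ltry.
apply: (invariant_of_gap m P sgP tn eps (fine (csup m P tn eps)) tn0 tnoo eps0).
  by rewrite -lte_fin fineK// -mE.
by move=> n A mA Aeps; rewrite -lee_fin fineK//; exact: cs.
Qed.

Lemma increasing_to_infty_exists : exists tn : nat -> R, increasing_to_infty tn.
Proof.
exists (fun n => n.+1%:R); split => //.
- by move=> i j ij; rewrite ler_nat ltnS.
- apply/cvgryPge => A; near=> n; rewrite (@le_trans _ _ n%:R)// ?ler_nat//.
  by near: n; exact: nbhs_infty_ger.
Unshelve. all: by end_near. Qed.

(** Each converse goes around the cycle; the sequence [tn0] instantiates the assertions about all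
    sequences and witnesses (v). *)
Lemma Linf_semigroup_equivalences : assertions_equivalent m P.
Proof.
have i_ii : (exists nu : {finite_measure set T -> \bar R}, nu `<< m /\ invariant_measure P nu) ->
    almost_invariant m P.
  by move=> [nu [num nuP]]; exact: (invariant_almost_invariant m P sgP nu).
have ii_iii : almost_invariant m P ->
    forall tn, increasing_to_infty tn -> mean_almost_invariant m P tn.
  by move=> ai tn [tn0 _ _]; exact: almost_invariant_mean.
have [tn0 tn0P] := increasing_to_infty_exists.
split; split.
- exact: i_ii.
- move=> /ii_iii/(_ _ tn0P)/mean_almost_invariant_cconst.
  exact: cconst_invariant.
- exact: ii_iii.
- move=> /(_ _ tn0P)/mean_almost_invariant_cconst/(cconst_invariant _ tn0P).
  exact: i_ii.
- by move=> mai tn /mai; exact: mean_almost_invariant_cconst.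
- move=> /(_ _ tn0P)/(cconst_invariant _ tn0P)/i_ii.
  exact: ii_iii.
- by move=> cc; exists tn0; split => //; exact: cc.
- move=> [tn [tnP /(cconst_invariant _ tnP)/i_ii/ii_iii mai]] sn /mai.
  exact: mean_almost_invariant_cconst.
Qed.

End equivalence.

(** * Strongly continuous semigroups on L^p *)

Section right_continuity.
Context {R : realType}.

(* [f] is the pointwise limit of the step functions [x |-> f (x_n)], with
   [x_n > x] the next point of the grid of mesh [1/(n+1)]. *)
Lemma measurable_right_continuous (f : R -> R) :
  (forall s, 0 < s -> forall e, 0 < e -> exists2 eta, 0 < eta &
    forall h, 0 < h < eta -> `|f (s + h) - f s| <= e) ->
  measurable_fun (`]0, +oo[%classic : set R) f.
Proof.
move=> rcf; set D := `]0, +oo[%classic : set R.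
pose N n (x : R) := Num.truncn (n.+1%:R * x).
pose E n k := D `&` [set x | k%:R <= n.+1%:R * x < k.+1%:R].
have NE n k x : E n k x -> N n x = k.
  by move=> [_ /= kx]; apply/eqP; rewrite /N truncn_eq ?kx// (le_trans _ (andP kx).1).
have mE n k : measurable (E n k).
  have -> : E n k = D `&` `[k%:R / n.+1%:R, k.+1%:R / n.+1%:R[%classic.
    congr (_ `&` _); apply/seteqP; split => x /=; rewrite in_itv/=;
      by rewrite ler_pdivrMr// ltr_pdivlMr// [x * _]mulrC.
  by apply: measurableI; exact: measurable_itv.
have DE n : D = \bigcup_k E n k.
  apply/seteqP; split => [x Dx|x [k _ []//]].
  exists (N n x) => //; split => //=; apply: truncn_itv.
  by move: Dx; rewrite /D /= in_itv/= andbT => x0; rewrite mulr_ge0// ltW.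
apply: (@measurable_fun_cvg _ _ _ D (fun n x => f ((N n x).+1%:R / n.+1%:R))).
  move=> n; rewrite (DE n); apply/measurable_fun_bigcup => // k.
  apply: (@eq_measurable_fun _ _ _ _ _ (cst (f (k.+1%:R / n.+1%:R)))).
    by move=> x; rewrite inE => /NE ->.
  exact: measurable_cst.
move=> x; rewrite /D /= in_itv/= andbT => x0; apply/cvgrPdist_le => e e0.
have [eta eta0 etaP] := rcf x x0 e e0.
near=> n.
have nx0 : 0 <= n.+1%:R * x by rewrite mulr_ge0// ltW.
have /andP[Nx xN] := truncn_itv nx0.
rewrite distrC -[X in f X](subrKC x) addrC addrC; apply: etaP; apply/andP; split.
  by rewrite subr_gt0 ltr_pdivlMr// mulrC.
rewrite ltrBlDr ltr_pdivrMr// -natr1 mulrDl addrC [x * _]mulrC.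
apply: ltr_leD => //.
rewrite -ltr_pdivrMl// mulr1.
rewrite (@lt_le_trans _ _ n%:R)// ?ler_nat//.
near: n; exact: nbhs_infty_gtr.
Unshelve. all: by end_near. Qed.

End right_continuity.

Section Lp_semigroup.
Context {d : measure_display} {T : measurableType d} {R : realType}.
Variables (m : {finite_measure set T -> \bar R}) (p : R).
Hypothesis p1 : 1 <= p.
Let p0 : 0 < p. Proof. exact: lt_le_trans p1. Qed.

Lemma essbdd_inLp f : essbdd m f -> inLp m p f.
Proof.
move=> [mf [M fM]]; split => //; rewrite unlock; apply: poweR_lty.
apply: (@le_lt_trans _ _ (\int[m]_x ((`|M| `^ p)%:E))%E).
  apply: ae_ge0_le_integral => //.
  - by move=> x _; rewrite /= lee_fin powR_ge0.
  - apply/measurable_EFinP.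
    apply: (@measurableT_comp _ _ _ _ _ _ (fun x : R => x `^ p)) => //.
    exact: measurableT_comp.
  - apply: filterS fM => x fxM _ /=; rewrite lee_fin ge0_ler_powR ?nnegrE ?(ltW p0)//.
    by rewrite (le_trans fxM)// ler_norm.
rewrite integral_cst// lte_mul_pinfty ?lee_fin ?powR_ge0//.
by rewrite -ge0_fin_numE// fin_num_measure.
Qed.

(** Hölder's inequality against the constant 1, with K = m(E)^(1/q) for the conjugate exponent q;
    the case p = 1 is apart, its conjugate exponent being infinite. *)
Lemma integral_le_Lnorm : exists2 K : R, 0 <= K &
  forall g : T -> R, measurable_fun setT g ->
    (\int[m]_x `|(g x)%:E| <= K%:E * Lnorm m p%:E (EFin \o g))%E.
Proof.
have [p_eq1|p_neq1] := eqVneq p 1.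
  by exists 1 => // g mg; rewrite p_eq1 mul1e Lnorm1.
have p_gt1 : 1 < p by rewrite lt_neqAle eq_sym p_neq1.
pose q := (1 - p^-1)^-1.
have q0 : 0 < q by rewrite invr_gt0 subr_gt0 invf_lt1.
have pq : p^-1 + q^-1 = 1 by rewrite invrK subrKC.
have NqE : (Lnorm m q%:E (EFin \o cst 1%R) = (fine (m setT `^ q^-1))%:E)%E.
  rewrite fineK; last by rewrite fin_num_poweR// fin_num_measure.
  exact: Lnorm_cst1.
exists (fine (m setT `^ q^-1)%E); first by rewrite fine_ge0// poweR_ge0.
move=> g mg; have := hoelder m mg (measurable_cst (1 : R)) p0 q0 pq.
rewrite NqE muleC Lnorm1; apply: le_trans.
rewrite [leRHS](eq_integral (fun x => `|(g x)%:E|%E))// => x _.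
by rewrite /= mulr1.
Qed.

Variable P : @opfam d T R.
Hypothesis scP : strongly_continuous_Markov_semigroup_Lp m p P.

Let Pstab t f : 0 <= t -> inLp m p f -> inLp m p (P t f).
Proof. by case: scP => -[_ + _ _ _] _; exact. Qed.
Let Plin t a f g : 0 <= t -> inLp m p f -> inLp m p g ->
  aeeq m (P t (fun x => a * f x + g x)) (fun x => a * P t f x + P t g x).
Proof. by case: scP => -[_ _ _ + _] _; exact. Qed.
Let Pbdd t : 0 <= t -> exists C : R, forall f, inLp m p f ->
  (Lnorm m p%:E (EFin \o P t f) <= C%:E * Lnorm m p%:E (EFin \o f))%E.
Proof. by case: scP => -[_ _ _ _ +] _; exact. Qed.
Let Ppos t f : 0 <= t -> inLp m p f -> {ae m, forall x, 0 <= f x} ->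
  {ae m, forall x, 0 <= P t f x}.
Proof. by case: scP => _ [+ _ _ _ _]; exact. Qed.
Let P1 t : 0 <= t -> aeeq m (P t (cst 1)) (cst 1).
Proof. by case: scP => _ [_ + _ _ _]; exact. Qed.
Let Pcomp t s f : 0 <= t -> 0 <= s -> inLp m p f ->
  aeeq m (P (t + s) f) (P t (P s f)).
Proof. by case: scP => _ [_ _ _ + _]; exact. Qed.
Let Pcont f : inLp m p f ->
  (Lnorm m p%:E (EFin \o (fun x => (P t f x - f x)%R)))%E @[t --> 0^'+] --> 0%E.
Proof. by case: scP => _ [_ _ _ _ +]; exact. Qed.

Let essLp f : essbdd m f -> inLp m p f. Proof. exact: essbdd_inLp. Qed.

(** Positivity applied to |M| + f and |M| - f, together with P_t 1 = 1, preserves the bound. *)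
Lemma Lp_semigroup_essbdd t f : 0 < t -> essbdd m f -> essbdd m (P t f).
Proof.
move=> t0 bf; have t0' := ltW t0; have b1 := essbdd_cst m 1.
have [mPf _] := Pstab t f t0' (essLp _ bf); split => //.
have [_ [M fM]] := bf.
exists `|M|.
have b0 := essbdd_cst m 0.
(* Linearity is given in the form a f + g, so scalar multiples require the image of 0. *)
have P0 : aeeq m (P t (cst 0)) (cst 0).
  have := Plin t (-1) (cst 0) (cst 0) t0' (essLp _ b0) (essLp _ b0).
  rewrite (_ : (fun x => -1 * cst 0 x + cst 0 x) = cst 0); last first.
    by apply/funext => x; rewrite /=; ring.
  by apply: filterS => x; rewrite /= => ->; ring.
have pos (a : R) : {ae m, forall x, `|M| * 1 + (a * f x + 0) >= 0} ->
    {ae m, forall x, 0 <= `|M| + a * P t f x}.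
  move=> af; have baf : essbdd m (fun x => a * f x + cst 0 x) by exact: essbdd_lin.
  have Pg := Ppos t (fun x => `|M| * cst 1 x + (a * f x + cst 0 x)) t0'
    (essLp _ (essbdd_lin m _ _ _ b1 baf)) af.
  have L1 := Plin t `|M| _ _ t0' (essLp _ b1) (essLp _ baf).
  have L2 := Plin t a _ _ t0' (essLp _ bf) (essLp _ b0).
  apply: filterS3 (filterI Pg L1) (filterI L2 P0) (P1 t t0').
  by move=> x [+ e1] [e2 e3] e4; rewrite e1 e2 e3 e4 /= mulr1 addr0.
have Pp : {ae m, forall x, 0 <= `|M| + 1 * P t f x}.
  apply: pos; apply: filterS fM => x; have := ler_norm M; rewrite ler_norml.
  by move=> ? /andP[? ?]; lra.
have Pn : {ae m, forall x, 0 <= `|M| + -1 * P t f x}.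
  apply: pos; apply: filterS fM => x; have := ler_norm M; rewrite ler_norml.
  by move=> ? /andP[? ?]; lra.
by apply: filterS2 Pp Pn => x ? ?; rewrite ler_norml; apply/andP; split; lra.
Qed.

Let Rint_le_Lnorm : exists2 K : R, 0 <= K & forall g : T -> R, inLp m p g ->
  `|\int[m]_x g x| <= K * fine (Lnorm m p%:E (EFin \o g)).
Proof.
have [K K0 KP] := integral_le_Lnorm; exists K => // g [mg gfin].
have Nfin : Lnorm m p%:E (EFin \o g) \is a fin_num by rewrite ge0_fin_numE ?Lnorm_ge0.
have ig : m.-integrable setT (EFin \o g).
  apply/integrableP; split; first exact/measurable_EFinP.
  by rewrite (le_lt_trans (KP g mg))// -(fineK Nfin) -EFinM ltry.
rewrite -lee_fin EFinM fineK// EFin_normr_Rintegral//.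
apply: le_trans (KP g mg); apply: le_abse_integral => //.
exact/measurable_EFinP.
Qed.

Lemma Lnorm_indic A : measurable A ->
  fine (Lnorm m p%:E (EFin \o (\1_A : T -> R))) = fine (m A) `^ p^-1.
Proof.
move=> mA; rewrite unlock.
under eq_integral => x _.
  rewrite /= (_ : (`|\1_A x| `^ p) = \1_A x :> R); last first.
    rewrite indicE; case: (x \in A); rewrite ?normr1 ?powR1// normr0 powR0// gt_eqF//.
  over.
rewrite integral_indic// setIT -[X in (X `^ _)%E]fineK ?fin_num_measure//.
Qed.

Lemma Linf_semigroup_of_Lp : Linf_semigroup m P.
Proof.
have [K K0 KP] := Rint_le_Lnorm.
have bounded t : 0 < t -> exists2 C : R, 0 <= C & forall f, inLp m p f ->
    `|\int[m]_x P t f x| <= C * fine (Lnorm m p%:E (EFin \o f)).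
  move=> t0; have [C CP] := Pbdd t (ltW t0).
  exists (K * `|C|); first by rewrite mulr_ge0.
  move=> f Lf; have LPf := Pstab t f (ltW t0) Lf.
  rewrite (le_trans (KP _ LPf))// -mulrA ler_wpM2l//.
  have Nf : Lnorm m p%:E (EFin \o f) \is a fin_num by rewrite ge0_fin_numE ?Lnorm_ge0//; exact: Lf.2.
  have NPf : Lnorm m p%:E (EFin \o P t f) \is a fin_num by rewrite ge0_fin_numE ?Lnorm_ge0//; exact: LPf.2.
  rewrite -lee_fin EFinM !fineK// (le_trans (CP f Lf))// lee_wpmul2r ?Lnorm_ge0//.
  by rewrite lee_fin ler_norm.
have bP t f := Lp_semigroup_essbdd t f.
split => //.
- by move=> t a f g t0 bf bg; apply: Plin; [exact: ltW|exact: essLp..].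
- by move=> t f t0 bf; apply: Ppos; [exact: ltW|exact: essLp].
- by move=> t t0; apply: P1; exact: ltW.
- by move=> t s f t0 s0 bf; apply: Pcomp; [exact: ltW..|exact: essLp].
(* The increment of m(P_s f) from s to s + h is m(P_s (P_h f - f)), bounded by C |P_h f - f|_p. Here
   [C] belongs to the fixed time [s], so strong continuity at 0 gives right continuity. *)
- move=> f bf; apply: measurable_right_continuous => s s0 e e0.
  have [C C0 CP] := bounded s s0.
  have eC : 0 < e / (C + 1) by rewrite divr_gt0// ltr_pwDr.
  have /fine_cvgP[_ /cvgrPdist_le /(_ _ eC) /nbhs_ballP[eta /= eta0 etaP]] :=
    Pcont f (essLp _ bf).
  exists eta => // h /andP[h0 heta].
  have bPh := bP h f h0 bf; have bPs := bP s f s0 bf.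
  have bB : essbdd m (fun x => P h f x - f x) by exact: essbddB.
  have Eq : \int[m]_x P (s + h) f x - \int[m]_x P s f x =
      \int[m]_x P s (fun x => P h f x - f x) x.
    have pm : pos_functional m (fun f => \int[m]_x f x) by exact: pf_Rintegral.
    have bsh : essbdd m (P (s + h) f) by apply: bP => //; rewrite addr_gt0.
    rewrite -(pfB _ _ pm)//; apply: (pf_ae_eq _ _ pm).
    - exact: essbddB.
    - exact: bP.
    have L := Plin s (-1) f (P h f) (ltW s0) (essLp _ bf) (essLp _ bPh).
    apply: filterS2 (Pcomp s h f (ltW s0) (ltW h0) (essLp _ bf)) L.
    move=> x ->; rewrite (_ : (fun x => -1 * f x + P h f x) = (fun x => P h f x - f x)).
      by move=> ->; ring.
    by apply/funext => y; ring.
  rewrite Eq (le_trans (CP _ (essLp _ bB)))//.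
  have := etaP h _ h0; rewrite /ball /= sub0r normrN (ger0_norm (ltW h0)) => /(_ heta).
  rewrite sub0r normrN => Nle.
  have {}Nle := le_trans (ler_norm _) Nle.
  rewrite (le_trans (ler_wpM2l C0 Nle))// mulrCA ler_piMr ?(ltW e0)//.
  by rewrite ler_pdivrMr ?mul1r ?lerDl// ltr_pwDr.
- move=> t e t0 e0; have [C C0 CP] := bounded t t0.
  have eC : 0 < e / (C + 1) by rewrite divr_gt0// ltr_pwDr.
  (* Solves C m(A)^(1/p) <= e, the indicator of A having p-norm m(A)^(1/p); C + 1 avoids division by
     zero. *)
  exists ((e / (C + 1)) `^ p); first exact: powR_gt0.
  move=> A mA mAe; have bA := essbdd_indic m A mA.
  rewrite (le_trans (ler_norm _))// (le_trans (CP _ (essLp _ bA)))// Lnorm_indic//.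
  have mAf : fine (m A) <= (e / (C + 1)) `^ p.
    by rewrite -lee_fin fineK// fin_num_measure.
  have : fine (m A) `^ p^-1 <= e / (C + 1).
    have pE : e / (C + 1) = ((e / (C + 1)) `^ p) `^ p^-1.
      by rewrite -powRrM mulfV ?lt0r_neq0// powRr1// ltW.
    by rewrite pE ge0_ler_powR ?nnegrE ?fine_ge0 ?powR_ge0// invr_ge0 ltW.
  move=> /(ler_wpM2l C0) /le_trans; apply.
  rewrite mulrCA ler_piMr ?(ltW e0)//.
  by rewrite ler_pdivrMr ?mul1r ?lerDl// ltr_pwDr.
Qed.

End Lp_semigroup.

(** * Transition functions *)

Section kernel_semigroup.
Context {d : measure_display} {T : measurableType d} {R : realType}.
Variables (m : {finite_measure set T -> \bar R}) (k : R -> R.-pker T ~> T).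
Hypothesis kP : measurable_Markov_transition_function m k.
Local Notation P := (transition_op k).
Implicit Types (t s : R) (f g : T -> R).

(** The null-function assumption, applied to the indicator of an exceptional set, says that almost
    no k_t(x, .) charges it. This lets pointwise kernels respect almost everywhere identities. *)
Lemma ae_kernel t (Q : T -> Prop) : 0 < t -> {ae m, forall x, Q x} ->
  {ae m, forall x, {ae k t x, forall y, Q y}}.
Proof.
move=> t0 [A [mA A0 QA]]; have [_ _ knull] := kP.
have k0 : (\int[m]_x `|k t x A| = 0)%E.
  have <- : (\int[m]_x \int[k t x]_y (\1_A y)%:E = 0)%E.
    apply: knull => //.
    by rewrite integral_indic// setIT.
  by apply: eq_integral => x _; rewrite integral_indic// setIT gee0_abs.
have /(ae_eq_integral_abs m measurableT) : measurable_fun setT (k t ^~ A).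
  exact: measurable_kernel.
move=> /iffLR/(_ k0); apply: filterS => x /(_ Logic.I) kx0.
by exists A.
Qed.

Lemma kernel_lty t x : (k t x setT < +oo)%E.
Proof. by rewrite prob_kernel ltry. Qed.

Lemma measurable_transition_op t f : measurable_fun setT f ->
  measurable_fun setT (P t f).
Proof.
move=> mf; apply: (measurableT_comp (@fine_measurable R setT measurableT)).
under eq_fun do rewrite integralE.
apply: emeasurable_funB; apply: measurable_fun_integral_kernel => //.
- by move=> U; exact: measurable_kernel.
- by apply: measurable_funepos; exact/measurable_EFinP.
- by move=> U; exact: measurable_kernel.
- by apply: measurable_funeneg; exact/measurable_EFinP.
Qed.

Lemma essbdd_kernel t f : 0 < t -> essbdd m f ->
  {ae m, forall x, essbdd (k t x) f}.
Proof.
move=> t0 [mf [M fM]]; apply: filterS (ae_kernel t _ t0 fM) => x fxM.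
by split => //; exists M.
Qed.

Lemma transition_op_lin t (a : R) f g : 0 < t -> essbdd m f -> essbdd m g ->
  aeeq m (P t (fun x => a * f x + g x)) (fun x => a * P t f x + P t g x).
Proof.
move=> t0 bf bg; apply: filterS2 (essbdd_kernel t f t0 bf) (essbdd_kernel t g t0 bg).
move=> x /(essbdd_integrable_lty _ _ (kernel_lty t x)) If.
move=> /(essbdd_integrable_lty _ _ (kernel_lty t x)) Ig.
rewrite /transition_op -!/(Rintegral _ _ _) RintegralD//; first by rewrite RintegralZl.
exact: (integrableZl measurableT a If).
Qed.

Lemma transition_op_ae_eq t f g : 0 < t -> measurable_fun setT f ->
  measurable_fun setT g -> aeeq m f g -> aeeq m (P t f) (P t g).
Proof.
move=> t0 mf mg fg; apply: filterS (ae_kernel t _ t0 fg) => x fgx.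
rewrite /transition_op; congr fine; apply: ae_eq_integral => //.
- exact/measurable_EFinP.
- exact/measurable_EFinP.
- by apply: filterS fgx => y -> .
Qed.

Lemma transition_op_cst t (c : R) x : P t (cst c) x = c.
Proof.
by rewrite /transition_op -/(Rintegral _ _ _) Rintegral_cst// [X in fine X]prob_kernel mulr1.
Qed.

Lemma transition_op_ge0 t f : 0 < t -> measurable_fun setT f ->
  {ae m, forall x, 0 <= f x} -> {ae m, forall x, 0 <= P t f x}.
Proof.
move=> t0 mf f0; apply: filterS (ae_kernel t _ t0 f0) => x f0x.
exact: Rintegral_ae_ge0.
Qed.

(** As for operators on L^p: positivity on |M| + f and |M| - f, with constants fixed by [P t]. *)
Lemma essbdd_transition_op t f : 0 < t -> essbdd m f -> essbdd m (P t f).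
Proof.
move=> t0 bf; have [mf [M fM]] := bf.
split; [exact: measurable_transition_op|exists `|M|].
have pos (a : R) : {ae m, forall x, 0 <= a * f x + `|M|} ->
    {ae m, forall x, 0 <= a * P t f x + `|M|}.
  move=> af; have bM := essbdd_cst m `|M|.
  have mg := (essbdd_lin m a f (cst `|M|) bf bM).1.
  apply: filterS2 (transition_op_ge0 t _ t0 mg af) (transition_op_lin t a f _ t0 bf bM).
  by move=> x /[swap] ->; rewrite transition_op_cst.
have Pp : {ae m, forall x, 0 <= 1 * P t f x + `|M|}.
  apply: pos; apply: filterS fM => x; have := ler_norm M; rewrite ler_norml.
  by move=> ? /andP[? ?]; lra.
have Pn : {ae m, forall x, 0 <= -1 * P t f x + `|M|}.
  apply: pos; apply: filterS fM => x; have := ler_norm M; rewrite ler_norml.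
  by move=> ? /andP[? ?]; lra.
by apply: filterS2 Pp Pn => x ? ?; rewrite ler_norml; apply/andP; split; lra.
Qed.

(** Truncating f + |M| gives an everywhere bounded nonnegative function, to which joint
    measurability and integration against composed kernels apply. *)
Lemma essbdd_shift_nonneg f : essbdd m f -> exists (M : R) (g : T -> R),
  [/\ measurable_fun setT g, forall x, 0 <= g x <= 2 * M &
      aeeq m f (fun x => - M * cst 1 x + g x)].
Proof.
move=> [mf [M fM]].
exists `|M|, (fun x => Num.min (2 * `|M|) (Num.max 0 (f x + `|M|))); split.
- apply: measurable_minr => //; apply: measurable_maxr => //; exact: measurable_funD.
- move=> x; rewrite ge_min lexx/= andbT le_min le_max lexx/= andbT.
  by rewrite mulr_ge0.
- apply: filterS fM => x; have := ler_norm M; rewrite ler_norml => ? /andP[? ?].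
  rewrite max_r; last by lra.
  by rewrite min_r /=; lra.
Qed.

Lemma integral_kernel_comp t s x g : 0 <= t -> 0 <= s -> measurable_fun setT g ->
  (forall y, 0 <= g y) ->
  (\int[k (t + s) x]_y (g y)%:E = \int[k t x]_y \int[k s y]_z (g z)%:E)%E.
Proof.
move=> t0 s0 mg g0; have [kcompE _ _] := kP.
(* Kernel composition expects a second kernel depending on both variables; [kernel_snd] lets [k s]
   ignore the first. *)
rewrite -(integral_kcomp (k t) (kernel.kernel_snd (T0 := T) (k s)) x); last 2 first.
- by move=> z; rewrite lee_fin.
- exact/measurable_EFinP.
by apply: eq_measure_integral => A mA _; exact: kcompE.
Qed.

(** The Chapman-Kolmogorov identity; the bound on [g] keeps the inner integral finite, so [fine]
    loses nothing. *)
Lemma transition_op_comp_nonneg t s g (M : R) x : 0 <= t -> 0 <= s ->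
  measurable_fun setT g -> (forall y, 0 <= g y <= M) ->
  P (t + s) g x = P t (P s g) x.
Proof.
move=> t0 s0 mg gM; have g0 y : 0 <= g y by have /andP[] := gM y.
rewrite {1}/transition_op integral_kernel_comp//.
rewrite [RHS]/transition_op; congr fine; apply: eq_integral => y _.
rewrite /transition_op fineK//.
apply: integrable_fin_num => //; apply: essbdd_integrable_lty.
  exact: kernel_lty.
split => //; exists M; apply: aeW => z.
by rewrite ger0_norm//; have /andP[] := gM z.
Qed.

Lemma essbdd_nonneg g (M : R) : measurable_fun setT g -> (forall x, 0 <= g x <= M) ->
  essbdd m g.
Proof.
move=> mg gM; split => //; exists M; apply: aeW => x.
by have /andP[g0 gxM] := gM x; rewrite ger0_norm.
Qed.

Lemma transition_op_shift t f g (M : R) : 0 < t -> essbdd m f -> essbdd m g ->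
  aeeq m f (fun x => - M * cst 1 x + g x) ->
  aeeq m (P t f) (fun x => - M * cst 1 x + P t g x).
Proof.
move=> t0 bf bg fg; have b1 := essbdd_cst m 1.
have mF := (essbdd_lin m (- M) (cst 1) g b1 bg).1.
apply: filterS2 (transition_op_ae_eq t _ _ t0 bf.1 mF fg)
  (transition_op_lin t (- M) (cst 1) g t0 b1 bg).
by move=> x -> ->; rewrite transition_op_cst.
Qed.

Lemma transition_op_comp t s f : 0 < t -> 0 < s -> essbdd m f ->
  aeeq m (P (t + s) f) (P t (P s f)).
Proof.
move=> t0 s0 bf; have [M [g [mg gM fg]]] := essbdd_shift_nonneg f bf.
have bg := essbdd_nonneg g _ mg gM.
have bPf := essbdd_transition_op s f s0 bf.
have bPg := essbdd_transition_op s g s0 bg.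
have fgs := transition_op_shift s f g M s0 bf bg fg.
apply: filterS2 (transition_op_shift (t + s) f g M (addr_gt0 t0 s0) bf bg fg)
  (transition_op_shift t _ _ M t0 bPf bPg fgs).
by move=> x -> ->; rewrite (transition_op_comp_nonneg t s g (2 * M))// ltW.
Qed.

Lemma measurable_integral_transition_op f : essbdd m f ->
  measurable_fun (`]0, +oo[%classic : set R) (fun t => \int[m]_x P t f x).
Proof.
move=> bf; have [M [g [mg gM fg]]] := essbdd_shift_nonneg f bf.
have bg := essbdd_nonneg g _ mg gM; have b1 := essbdd_cst m 1.
have g0 y : 0 <= g y by have /andP[] := gM y.
have [_ kmeas _] := kP.
pose D := (`[0%R, +oo[%classic : set R) `*` [set: T].
(* Extension by 0 to negative times puts the integrand on the whole product, where Tonelli's theorem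
   gives measurability in time. *)
pose h : R * T -> \bar R := (fun z => \int[k z.1 z.2]_y (g y)%:E)%E \_ D.
have mD : measurable D by exact: measurableX.
have mh : measurable_fun setT h.
  by apply: (measurable_restrictT _ mD).1; exact: kmeas.
have h0 z : (0 <= h z)%E.
  rewrite /h patchE; case: ifP => // _.
  by apply: integral_ge0 => y _; rewrite lee_fin.
have mH := measurable_fun_fubini_tonelli_F (m2 := m) h mh h0.
apply: (@eq_measurable_fun _ _ _ _ _ (fun t => - M * fine (m setT) + fine (fubini_F m h t))).
  move=> t; rewrite inE /= in_itv/= andbT => t0.
  have pm : pos_functional m (fun f => \int[m]_x f x) by exact: pf_Rintegral.
  have bPg := essbdd_transition_op t g t0 bg.
  rewrite (pf_ae_eq _ _ pm _ _ _ _ (transition_op_shift t f g M t0 bf bg fg)).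
  - rewrite (pf_lin _ _ pm)// Rintegral_cst// mul1r; congr (_ + _).
    rewrite /fubini_F /Rintegral; congr fine; apply: eq_integral => x _.
    rewrite /h patchE mem_set/=; last by split => //=; rewrite in_itv/= andbT ltW.
    rewrite /transition_op fineK//.
    apply: integrable_fin_num => //; apply: essbdd_integrable_lty.
      exact: kernel_lty.
    split => //; exists (2 * M); apply: aeW => z.
    by rewrite ger0_norm//; have /andP[] := gM z.
  - exact: essbdd_transition_op.
  - exact: essbdd_lin.
apply: measurable_funD => //; apply: measurable_funTS.
exact: (measurableT_comp (@fine_measurable R setT measurableT)).
Qed.

(** The set function A |-> m(k_t 1_A) is a finite measure dominated by [m], so the epsilon-eta form
    of absolute continuity applies to it. *)
Lemma transition_op_continuous t e : 0 < t -> 0 < e -> exists2 eta, 0 < eta &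
  forall A, measurable A -> (m A <= eta%:E)%E -> \int[m]_x P t \1_A x <= e.
Proof.
move=> t0 e0.
pose lam A := (\int[m]_x k t x A)%E.
have mk A : measurable A -> measurable_fun setT (k t ^~ A) by exact: measurable_kernel.
have lam0 : lam set0 = 0%E by apply: integral0_eq => x _; rewrite measure0.
have lam_ge0 A : (0 <= lam A)%E by exact: integral_ge0.
have lam_sadd : semi_sigma_additive lam.
  move=> F mF tF mUF; rewrite [X in _ --> X](_ : _ = \sum_(0 <= i <oo) lam (F i))%E.
    exact: is_cvg_nneseries.
  rewrite /lam -integral_nneseries//; last by move=> n; exact: mk.
  apply: eq_integral => x _; apply/esym/cvg_lim => //.
  exact: measure_semi_sigma_additive.
pose lam_mix := isMeasure.Build d T R lam lam0 lam_ge0 lam_sadd.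
pose lam1 : {measure set T -> \bar R} := HB.pack (lam : set T -> \bar R) lam_mix.
have lam_fin : fin_num_fun lam1.
  move=> A mA; rewrite ge0_fin_numE//.
  apply: (@le_lt_trans _ _ (\int[m]_x 1)%E).
    apply: ge0_le_integral => //; first exact: mk.
    by move=> x _; rewrite -(@prob_kernel _ _ _ _ _ (k t) x) le_measure ?inE.
  by rewrite integral_cst// mul1e -ge0_fin_numE// fin_num_measure.
pose lam_fmix := Measure_isFinite.Build d T R lam1 lam_fin.
pose lam2 : {finite_measure set T -> \bar R} :=
  HB.pack (lam : set T -> \bar R) lam_mix lam_fmix.
have [_ _ knull] := kP.
have lamE A : measurable A -> (\int[m]_x \int[k t x]_y (\1_A y)%:E)%E = lam A.
  by move=> mA; apply: eq_integral => x _; rewrite integral_indic// setIT.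
have lam_dom : lam2 `<< m.
  apply/null_content_dominatesP => A mA A0.
  rewrite -[LHS](lamE A mA); apply: knull => //.
  by rewrite integral_indic// setIT.
have [eta eta0 etaP] := dominates_continuous m lam2 lam_dom e e0.
exists eta => // A mA /(etaP A mA).
rewrite -[X in (X <= _)%E]fineK ?fin_num_measure// lee_fin; apply: le_trans.
rewrite /Rintegral le_eqVlt; apply/orP; left; apply/eqP; congr fine.
apply: eq_integral => x _; rewrite /transition_op integral_indic// setIT fineK//.
by rewrite ge0_fin_numE// (le_lt_trans _ (kernel_lty t x))// le_measure ?inE.
Qed.

Lemma Linf_semigroup_of_kernel : Linf_semigroup m P.
Proof.
split.
- exact: essbdd_transition_op.
- exact: transition_op_lin.
- by move=> t f t0 [mf _]; exact: transition_op_ge0.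
- by move=> t t0; apply: aeW => x; rewrite transition_op_cst.
- exact: transition_op_comp.
- exact: measurable_integral_transition_op.
- exact: transition_op_continuous.
Qed.

End kernel_semigroup.

Theorem theorem2p4 (d : measure_display) (T : measurableType d) (R : realType)
    (m : {finite_measure set T -> \bar R}) :
  (0 < m setT)%E ->
  (forall (p : R) (P : @opfam d T R),
      strongly_continuous_Markov_semigroup_Lp m p P ->
      assertions_equivalent m P) /\
  (forall k : R -> R.-pker T ~> T,
      measurable_Markov_transition_function m k ->
      assertions_equivalent m (transition_op k)).

Proof.
move=> mT0; split=> [p P scP|k kP]; apply: Linf_semigroup_equivalences => //.
- by have [[p1 _ _ _ _] _] := scP; exact: (Linf_semigroup_of_Lp m p p1 P scP).
- exact: Linf_semigroup_of_kernel.
Qed.
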